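(* Let $\mathcal D=\mathcal D_0+Q$ be the one-dimensional discrete Dirac operator on $\mathbf l^2=\ell^2(\mathbb Z)\oplus\ell^2(\mathbb Z)$ with mass $m>0$ and real matrix potential $Q=(q^{ij})_{i,j=1,2}$ satisfying $q^{12}_n=q^{21}_n$ and $q^{21}_n\neq-1$ for all $n\in\mathbb Z$. Let $q^{ij}\in\ell^1$ for all $i,j$, let $\mathcal R(\lambda)=(\mathcal D-\lambda)^{-1}$, and let $\Gamma=(-\sqrt{m^2+4},-m)\cup(m,\sqrt{m^2+4})$. Then for every $\lambda\in\Gamma$ and every $\sigma>1/2$ the limits $\mathcal R(\lambda\pm\mathrm i0)$ exist and the convergence $$\mathcal R(\lambda\pm\mathrm i\varepsilon)\to\mathcal R(\lambda\pm\mathrm i0),\quad \varepsilon\to0+,$$ holds in $\mathcal L(\mathbf l^2_\sigma,\mathbf l^2_{-\sigma})$ (operator norm).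
   Context: Weighted spaces: $\ell^2_\sigma=\ell^2_\sigma(\mathbb Z)$, $\sigma\in\mathbb R$, has norm $\Vert u\Vert_{\ell^2_\sigma}=\big(\sum_{n\in\mathbb Z}(1+|n|)^{2\sigma}|u(n)|^2\big)^{1/2}$; $\mathbf l^2_\sigma=\ell^2_\sigma\oplus\ell^2_\sigma$. $\mathcal L(X,Y)$ denotes the bounded linear operators from $X$ to $Y$ with the operator norm. Dirac operator: for $\mathbf w=(\mathbf w_n)_{n\in\mathbb Z}$, $\mathbf w_n=(u_n,v_n)\in\mathbb C^2$, $\mathcal D_0=\begin{pmatrix} m& d\\ d^*&-m\end{pmatrix}$, $(du)_n=u_n-u_{n+1}$, $(d^*u)_n=u_n-u_{n-1}$, and $(Q\mathbf w)_n=Q_n\mathbf w_n$ with $Q_n=(q_n^{ij})_{i,j=1,2}$ a real $2\times2$ matrix. *)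

(* Defs.v *)
From HB Require Import structures.
From mathcomp Require Import all_boot all_order all_algebra.
From mathcomp Require Import complex.
From mathcomp Require Import all_classical all_reals all_analysis.

Set Implicit Arguments.
Unset Strict Implicit.
Unset Printing Implicit Defensive.

Import Order.TTheory GRing.Theory Num.Theory.
Import numFieldNormedType.Exports.

Local Open Scope classical_set_scope.
Local Open Scope ring_scope.
Local Open Scope complex_scope.

(* [w n] is the column vector with entries u_n and v_n. *)
Notation spinor R := (int -> 'cV[R[i]]_2).

Section Spaces.
Variable R : realType.
Implicit Types (s t : R) (u : int -> R[i]) (w : spinor R).

Definition upper w : int -> R[i] := fun n => w n 0 0.
Definition lower w : int -> R[i] := fun n => w n 1 0.

(* Norms take values in [\bar R]; membership in a space means finite norm. *)
Definition ell2_norm s u : \bar R :=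
  sqrte (\esum_(n in [set: int])
           ((1 + `|n|%:~R) `^ (2 * s) * Normc.normc (u n) ^+ 2)%:E).

Definition l2_norm s w : \bar R :=
  sqrte (ell2_norm s (upper w) ^+ 2 + ell2_norm s (lower w) ^+ 2)%E.

Definition l2 s : set (spinor R) := [set w | (l2_norm s w < +oo)%E].

(* Operators with domain [l2 s] are total functions on sequences; their values
   outside [l2 s] are never used. *)
Definition op_norm s t (A : spinor R -> spinor R) : \bar R :=
  ereal_sup [set l2_norm t (A w) | w in [set w | (l2_norm s w <= 1)%E]].

Definition linear_on s (A : spinor R -> spinor R) : Prop :=
  forall (a : R[i]) w1 w2, l2 s w1 -> l2 s w2 ->
    A (a *: w1 + w2) = a *: A w1 + A w2.

Definition bounded_ops s t : set (spinor R -> spinor R) :=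
  [set A | [/\ set_fun (l2 s) (l2 t) A, linear_on s A
             & (op_norm s t A < +oo)%E]].

End Spaces.

Section Dirac.
Variable R : realType.
Implicit Types (m : R) (Q : int -> 'M[R]_2) (w : spinor R) (z : R[i]).

Definition fwd_diff (u : int -> R[i]) : int -> R[i] := fun n => u n - u (n + 1).
Definition bwd_diff (u : int -> R[i]) : int -> R[i] := fun n => u n - u (n - 1).

Definition free_dirac_op m w : spinor R := fun n =>
  \col_i (if i == 0 then m%:C * upper w n + fwd_diff (lower w) n
          else bwd_diff (upper w) n - m%:C * lower w n).

Definition potential Q w : spinor R := fun n =>
  map_mx (fun x : R => x%:C) (Q n) *m w n.

Definition dirac_op m Q w : spinor R := free_dirac_op m w + potential Q w.

(* The inverse of D - z as an operator on the unweighted space [l2 0]. *)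
Definition resolvent m Q z : spinor R -> spinor R :=
  'pinv_(fun=> 0) (l2 0) (fun w => dirac_op m Q w - z *: w).

Definition resolvent_set m Q : set R[i] :=
  [set z | set_bij (l2 0) (l2 0) (fun w => dirac_op m Q w - z *: w) /\
           bounded_ops 0 0 (resolvent m Q z)].

Definition Gamma m : set R :=
  [set x | - Num.sqrt (m ^+ 2 + 4) < x < - m] `|`
  [set x | m < x < Num.sqrt (m ^+ 2 + 4)].

End Dirac.

(* Main.v *)
(* The equation [(D - z) w = 0] is a first order recursion for the state
   [(u_(n-1), v_n)] whose transfer matrix has determinant 1 and differs from the
   free one by a summable perturbation. The free matrix has eigenvalues [th] and
   [th^-1], where [th + th^-1 = 2 + m^2 - z^2], with [|th| = 1] and [th] non real
   for [z] in [Gamma] and [|th| < 1] for [Im z <> 0]. In a norm adapted to its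
   eigenvectors the rescaled free matrix is a contraction, so the Jost solution
   decaying at -oo is the limit of products of transfer matrices; the one at +oo
   is obtained by the reflection exchanging [n, u] with [-n, v]. The flux
   [Im (u_(n-1)^* v_n)] changes by [- Im z (|u_n|^2 + |v_n|^2)] at each step,
   which gives injectivity of [D - z] for [Im z <> 0] and shows that the two Jost
   solutions have fluxes of opposite signs, hence a nonzero Wronskian, up to the
   real axis. The resulting Green kernel is bounded by [B |th|^|n - k|] uniformly
   in [z] near [lambda] and converges pointwise, so that it converges in the
   Hilbert-Schmidt norm with weights [(1 + |n|)^(- 2 sigma)], which are summable
   as [sigma > 1/2]. *)

Require Import Defs.
From mathcomp Require Import all_boot all_order all_algebra.
From mathcomp Require Import complex.
From mathcomp Require Import all_classical all_reals all_analysis.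
From mathcomp Require Import ring lra zify.

Import Order.TTheory GRing.Theory Num.Theory.
Import numFieldNormedType.Exports.

Local Open Scope classical_set_scope.
Local Open Scope ring_scope.
Local Open Scope complex_scope.
Import Normc.

(** * Complex sequences *)

Section Complex.
Context {R : realType}.
Implicit Types z w : R[i].

(** Off the real axis the Green operator is bounded on unweighted [l2] by the Schur test, which
    needs [|th| < 1]. At the limit point [|th| = 1], the kernel no longer decays and only the
    weights make the sums converge. The estimates that must survive the limit therefore use
    [|th| <= 1] alone, and the constants of the Jost solutions depend only on [L], [kap] and a bound
    on its sum, which are chosen once for all small [eps]. On the axis both roots [th] and [th^-1]
    have modulus 1, so the root is fixed by a sign: off the axis the root inside the disc has an
    imaginary part of the sign of [lambda * Im z], and the boundary root is required to have the
    same sign. The roots are picked pointwise; their convergence is a consequence of this sign. On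
    the axis the flux of a solution is constant, so its sign cannot come from decay. It is read off
    at infinity from the free eigenvector, and the two sides get opposite signs because
    [al0 * be0 = lambda^2 - m^2 > 0]. Both boundary values come from the single family
    [z = lambda + i s eps], with [s = 1] and [s = -1]. *)

Lemma normc_ge0 z : 0 <= normc z.
Proof. by case: z => x y; apply: sqrtr_ge0. Qed.

Lemma normcD z w : normc (z + w) <= normc z + normc w.
Proof. exact: le_normcD. Qed.

Lemma normcB z w : normc (z - w) <= normc z + normc w.
Proof. by rewrite -(normcN w); exact: normcD. Qed.

Lemma normc_sqr z : normc z ^+ 2 = complex.Re z ^+ 2 + complex.Im z ^+ 2.
Proof. by case: z => x y; rewrite /normc sqr_sqrtr // addr_ge0 ?sqr_ge0. Qed.

Lemma normc_gt0 z : z != 0 -> 0 < normc z.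
Proof.
move=> z0; rewrite lt_neqAle normc_ge0 andbT eq_sym.
by apply: contra z0 => /eqP/eq0_normc ->.
Qed.

Lemma Re_le_normc z : `|complex.Re z| <= normc z.
Proof.
rewrite -(@ler_pXn2r _ 2) ?nnegrE ?normc_ge0 // normc_sqr.
by rewrite real_normK ?num_real // lerDl sqr_ge0.
Qed.

Lemma Im_le_normc z : `|complex.Im z| <= normc z.
Proof.
rewrite -(@ler_pXn2r _ 2) ?nnegrE ?normc_ge0 // normc_sqr.
by rewrite real_normK ?num_real // lerDr sqr_ge0.
Qed.

Lemma normcX z n : normc (z ^+ n) = normc z ^+ n.
Proof. by elim: n => [|n IH]; rewrite ?normc1 // !exprS normcM IH. Qed.

Lemma normcXz z (n : int) : normc (z ^ n) = normc z ^ n.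
Proof. by case: n => n; rewrite /exprz ?normcV normcX. Qed.

Lemma normc_real (x : R) : normc x%:C = `|x|.
Proof. by rewrite /normc /= expr0n addr0 sqrtr_sqr. Qed.

Lemma normc_conj z : normc (conjc z) = normc z.
Proof. by case: z => x y; rewrite /normc /= sqrrN. Qed.

Lemma complex_ReM z w : complex.Re (z * w) =
  complex.Re z * complex.Re w - complex.Im z * complex.Im w.
Proof. by case: z => x y; case: w. Qed.

Lemma complex_ImM z w : complex.Im (z * w) =
  complex.Re z * complex.Im w + complex.Im z * complex.Re w.
Proof. by case: z => x y; case: w. Qed.

Lemma Re_conjc z : complex.Re (conjc z) = complex.Re z.
Proof. by case: z. Qed.

Lemma Im_conjc z : complex.Im (conjc z) = - complex.Im z.
Proof. by case: z. Qed.

Lemma complexP z w : complex.Re z = complex.Re w ->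
  complex.Im z = complex.Im w -> z = w.
Proof. by case: z => x y; case: w => x' y' /= -> ->. Qed.

Lemma ler_normc_sum (I : Type) (r : seq I) (F : I -> R[i]) :
  normc (\sum_(i <- r) F i) <= \sum_(i <- r) normc (F i).
Proof.
elim: r => [|a r IH]; first by rewrite !big_nil normc0.
by rewrite !big_cons (le_trans (normcD _ _)) // lerD2l.
Qed.

(** Limits are taken on real and imaginary parts, so that completeness and uniqueness of limits come
    from [R]; [ccvg_dist] and [dist_ccvg] give the equivalence with convergence of the modulus of
    the difference. *)
Definition ccvg {T : Type} (F : set_system T) (f : T -> R[i]) (l : R[i]) :=
  complex.Re (f x) @[x --> F] --> complex.Re l /\
  complex.Im (f x) @[x --> F] --> complex.Im l.

Section ccvg.
Context {T : Type} {F : set_system T} {FF : ProperFilter F}.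
Implicit Types (f g : T -> R[i]) (a b : R[i]).

Lemma ccvg_cst a : ccvg F (fun=> a) a.
Proof. by split; apply: cvg_cst. Qed.

Lemma ccvgD f g a b : ccvg F f a -> ccvg F g b ->
  ccvg F (fun x => f x + g x) (a + b).
Proof.
move=> [f1 f2] [g1 g2]; split; rewrite raddfD;
  by under eq_fun do rewrite raddfD /=; apply: cvgD.
Qed.

Lemma ccvgN f a : ccvg F f a -> ccvg F (fun x => - f x) (- a).
Proof.
move=> [f1 f2]; split; rewrite raddfN;
  by under eq_fun do rewrite raddfN /=; apply: cvgN.
Qed.

Lemma ccvgB f g a b : ccvg F f a -> ccvg F g b ->
  ccvg F (fun x => f x - g x) (a - b).
Proof. by move=> fa gb; apply: ccvgD => //; apply: ccvgN. Qed.

Lemma ccvgM f g a b : ccvg F f a -> ccvg F g b ->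
  ccvg F (fun x => f x * g x) (a * b).
Proof.
move=> [f1 f2] [g1 g2]; split.
  rewrite complex_ReM; under eq_fun do rewrite complex_ReM.
  by apply: cvgB; apply: cvgM.
rewrite complex_ImM; under eq_fun do rewrite complex_ImM.
by apply: cvgD; apply: cvgM.
Qed.

Lemma ccvg_conj f a : ccvg F f a -> ccvg F (fun x => conjc (f x)) (conjc a).
Proof.
move=> [f1 f2]; split.
  by rewrite Re_conjc; under eq_fun do rewrite Re_conjc.
by rewrite Im_conjc; under eq_fun do rewrite Im_conjc; apply: cvgN.
Qed.

Lemma ccvg_sqr_normc f a : ccvg F f a ->
  normc (f x) ^+ 2 @[x --> F] --> normc a ^+ 2.
Proof.
move=> [f1 f2]; rewrite normc_sqr; under eq_fun do rewrite normc_sqr.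
by apply: cvgD; rewrite !expr2; under eq_fun do rewrite expr2; apply: cvgM.
Qed.

Lemma ccvg_normc f a : ccvg F f a -> normc (f x) @[x --> F] --> normc a.
Proof.
move=> /ccvg_sqr_normc fa.
rewrite -[normc a]ger0_norm ?normc_ge0 // -sqrtr_sqr.
under eq_fun do rewrite -[normc _]ger0_norm ?normc_ge0 // -sqrtr_sqr.
by apply: continuous_cvg => //; exact: sqrt_continuous.
Qed.

Lemma ccvg_dist f a : ccvg F f a -> normc (f x - a) @[x --> F] --> (0 : R).
Proof.
move=> fa; rewrite -[X in _ --> X](@normc0 R) -[X in normc X](subrr a).
by apply: ccvg_normc; apply: ccvgB => //; exact: ccvg_cst.
Qed.

Lemma dist_ccvg f a : normc (f x - a) @[x --> F] --> (0 : R) -> ccvg F f a.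
Proof.
move=> h; have k (p : {additive R[i] -> R}) : (forall z, `|p z| <= normc z) ->
    p (f x) @[x --> F] --> p a.
  move=> pn; apply/cvgrPdist_le => e e0; near=> x.
  rewrite distrC -raddfB (le_trans (pn _)) //.
  near: x; move/cvgrPdist_le : h => /(_ e e0); apply: filterS => x.
  by rewrite sub0r normrN ger0_norm ?normc_ge0.
by split; apply: k; [exact: Re_le_normc | exact: Im_le_normc].
Unshelve. all: by end_near. Qed.

Lemma ccvg_unique f a b : ccvg F f a -> ccvg F f b -> a = b.
Proof.
move=> [f1 f2] [g1 g2]; apply: complexP.
  exact: (cvg_unique _ f1 g1).
exact: (cvg_unique _ f2 g2).
Qed.

Lemma ccvgV f a : a != 0 -> ccvg F f a -> ccvg F (fun x => (f x)^-1) a^-1.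
Proof.
move=> a0 fa; have na := normc_gt0 _ a0; apply: dist_ccvg.
have fd := ccvg_dist _ _ fa.
have e : normc (f x - a) * (normc (f x))^-1 * (normc a)^-1 @[x --> F]
  --> (0 : R).
  rewrite -[X in _ --> X](mul0r (normc a)^-1); apply: cvgMl.
  rewrite -[X in _ --> X](mul0r (normc a)^-1); apply: cvgM => //.
  by apply: cvgV; [rewrite gt_eqF | exact: ccvg_normc].
apply: cvg_trans e; apply: near_eq_cvg; near=> x.
have fx : f x != 0.
  have : 0 < normc (f x).
    by near: x; apply: (cvgr_gt _ (ccvg_normc _ _ fa)).
  by apply: contraTneq => ->; rewrite normc0 ltxx.
rewrite -!normcV -!normcM (_ : (f x)^-1 - a^-1 = - ((f x - a) / f x / a));
  last first.
  by field; rewrite fx a0.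
by rewrite normcN.
Unshelve. all: by end_near. Qed.

Lemma ccvg_ext f g a : (forall x, f x = g x) -> ccvg F f a -> ccvg F g a.
Proof. by move=> /funext ->. Qed.

End ccvg.

Lemma ccvg_cauchy (s : nat -> R[i]) :
  (forall e, 0 < e -> exists N, forall M, normc (s (N + M)%N - s N) <= e) ->
  exists l, ccvg \oo s l.
Proof.
move=> h; have k (p : {additive R[i] -> R}) : (forall z, `|p z| <= normc z) ->
    cvg (p (s n) @[n --> \oo]).
  move=> pn; apply/cauchy_cvgP/cauchy_exP => e e0.
  have [N hN] := h (e / 2) (divr_gt0 e0 (ltr0Sn _ 1)).
  exists (p (s N)); exists N => // n /= Nn.
  rewrite /ball /= distrC -raddfB (le_lt_trans (pn _)) //.
  rewrite (le_lt_trans (_ : _ <= e / 2)) //; last by lra.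
  by rewrite -(subnKC Nn); exact: hN.
have /cvg_ex[a sa] := k _ Re_le_normc; have /cvg_ex[b sb] := k _ Im_le_normc.
by exists (a +i* b).
Qed.

End Complex.

(** * Sums over the integers *)

Section IntSums.
Context {R : realType}.
Implicit Types (f g : int -> R) (M : R) (r : seq int).

(** The interval from [- N] to [N - 1], split along the constructors of [int] so that a sum over it
    becomes two sums over [nat]. *)
Definition window N : seq int :=
  [seq Posz i | i <- iota 0 N] ++ [seq Negz i | i <- iota 0 N].

Lemma mem_window N (k : int) : (k \in window N)
  = (match k with Posz i => i | Negz i => i end < N)%N.
Proof.
rewrite mem_cat; case: k => i.
  rewrite mem_map; last by move=> x y [].
  rewrite mem_iota add0n /= -[RHS]orbF; congr (_ || _).
  by apply/negP => /mapP[].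
rewrite orbC mem_map; last by move=> x y [].
rewrite mem_iota add0n /= -[RHS]orbF; congr (_ || _).
by apply/negP => /mapP[].
Qed.

Lemma mem_window_int N (k : int) : (k \in window N) = (- N%:Z <= k < N%:Z).
Proof. by rewrite mem_window; case: k => i; lia. Qed.

Lemma window_uniq N : uniq (window N).
Proof.
rewrite cat_uniq !map_inj_uniq ?iota_uniq ?andbT /=; try by move=> x y [].
by apply/hasPn => _ /mapP[i _ ->]; apply/negP => /mapP[].
Qed.

Lemma window_exhaust r : exists N, forall N',
  (N <= N')%N -> {subset r <= window N'}.
Proof.
elim: r => [|k r [N IH]]; first by exists 0%N.
exists (maxn N (match k with Posz i => i | Negz i => i end).+1) => N' h j.
rewrite inE => /orP[/eqP ->|jr]; first by rewrite mem_window; case: (k) h => i;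
  lia.
by apply: IH => //; lia.
Qed.

(** For nonnegative [f] this bounds the unordered sum over the integers ([esum_zbnd]), in a form
    free of limits and extended reals. *)
Definition sum_bounded f M := forall r, uniq r -> \sum_(k <- r) f k <= M.

Lemma ler_sum_subset f r r' : (forall k, 0 <= f k) -> uniq r -> uniq r' ->
  {subset r <= r'} -> \sum_(k <- r) f k <= \sum_(k <- r') f k.
Proof.
move=> f0 ur ur' sr; rewrite (perm_big _ (_ : perm_eq r' (r ++ [seq k <- r' | k
  \notin r]))) /=.
  by rewrite big_cat /= lerDl sumr_ge0.
apply: uniq_perm => //.
  rewrite cat_uniq ur filter_uniq //= andbT; apply/hasPn => k.
  by rewrite mem_filter => /andP[].
move=> k; rewrite mem_cat mem_filter; case: (boolP (k \in r)) => //= /sr.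
by [].
Qed.

Lemma sum_bounded_le f g M : (forall k,
  f k <= g k) -> sum_bounded g M -> sum_bounded f M.
Proof. by move=> fg gM r ur; rewrite (le_trans _ (gM r ur)) // ler_sum. Qed.

Lemma sum_bounded_ge0 f M : sum_bounded f M -> 0 <= M.
Proof. by move=> /(_ [::] isT); rewrite big_nil. Qed.

Lemma sum_bounded_single f M k : sum_bounded f M -> f k <= M.
Proof. by move=> /(_ [:: k] isT); rewrite big_seq1. Qed.

Lemma sum_boundedD f g M M' : sum_bounded f M -> sum_bounded g M' ->
  sum_bounded (fun k => f k + g k) (M + M').
Proof. by move=> h h' r ur; rewrite big_split lerD ?h ?h'. Qed.

Lemma sum_boundedZ f M c : 0 <= c -> sum_bounded f M ->
  sum_bounded (fun k => c * f k) (c * M).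
Proof. by move=> c0 h r ur; rewrite -mulr_sumr ler_wpM2l ?h. Qed.

Lemma sum_bounded_inj f M (h : int -> int) : injective h ->
  sum_bounded f M -> sum_bounded (f \o h) M.
Proof.
move=> hi fM r ur; rewrite -(big_map h predT) fM //.
by rewrite map_inj_uniq.
Qed.

(** A finite set whose sum comes within [e] of the supremum leaves less than [e] to any finite set
    disjoint from it. *)
Lemma sum_bounded_tail f M : (forall k,
  0 <= f k) -> sum_bounded f M -> forall e, 0 < e ->
  exists N, forall r, uniq r -> (forall k, k \in r -> k \notin window N) ->
    \sum_(k <- r) f k <= e.
Proof.
move=> f0 fM e e0; pose A := [set x | exists2 r,
  uniq r & x = \sum_(k <- r) f k].
have supA : has_sup A.
  split; first by exists 0, [::]; rewrite ?big_nil.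
  by exists M => _ [r ur ->]; exact: fM.
have [_ [r0 ur0 ->] sr0] := sup_adherent e0 supA.
have [N sN] := window_exhaust r0; exists N => r ur rN.
have : \sum_(k <- r0 ++ r) f k <= sup A.
  apply: ub_le_sup; first by case: supA.
  exists (r0 ++ r) => //; rewrite cat_uniq ur0 ur andbT /=.
  apply/hasPn => k kr; apply: contra (rN _ kr) => kr0; exact: sN.
by rewrite big_cat /=; lra.
Qed.

(** Cauchy-Schwarz without square roots. In the induction the cross term [2 a X] is at most
    [b Z + Y c], because [(a X)^2 <= (b c) (Y Z)] and the arithmetic mean of [b Z] and [Y c]
    dominates their geometric mean. *)
Lemma sqr_sum_le (I : Type) (r : seq I) (x y z : I -> R) :
  (forall i, 0 <= y i) -> (forall i, 0 <= z i) -> (forall i,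
    x i ^+ 2 <= y i * z i) ->
  (\sum_(i <- r) x i) ^+ 2 <= (\sum_(i <- r) y i) * (\sum_(i <- r) z i).
Proof.
move=> y0 z0 xyz; elim: r => [|i r IH]; first by rewrite !big_nil expr0n mulr0.
rewrite !big_cons; move: (xyz i) IH (y0 i) (z0 i).
have : 0 <= \sum_(j <- r) y j by apply: sumr_ge0.
have : 0 <= \sum_(j <- r) z j by apply: sumr_ge0.
move: (x i) (y i) (z i) (\sum_(j <- r) x j) (\sum_(j <- r) y j) (\sum_(j <- r)
  z j).
move=> a b c X Y Z Z0 Y0 ab XYZ b0 c0.
have h : `|a * X| <= (b * Z + Y * c) / 2.
  rewrite -(@ler_pXn2r _ 2) ?nnegrE //;
    last by rewrite divr_ge0 // addr_ge0 // mulr_ge0.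
  rewrite real_normK ?num_real // exprMn.
  rewrite (le_trans (ler_pM _ _ ab XYZ)) ?sqr_ge0 //.
  have := sqr_ge0 (b * Z - Y * c); lra.
have := ler_norm (a * X); lra.
Qed.

Definition zcvg (f : int -> R[i]) (l : R[i]) :=
  ccvg \oo (fun N => \sum_(k <- window N) f k) l.

Definition zsum (f : int -> R[i]) : R[i] := xget 0 (zcvg f).

Lemma zcvg_ex (f : int -> R[i]) M : sum_bounded (fun k => normc (f k)) M ->
  exists l, zcvg f l.
Proof.
move=> fM; apply: ccvg_cauchy => e e0.
have [N hN] := sum_bounded_tail _ _ (fun k => normc_ge0 (f k)) fM _ e0.
exists N => L; pose t := [seq k <- window (N + L) | k \notin window N].
have tE k : (k \in t) = (k \notin window N) && (k \in window (N + L)).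
  by rewrite mem_filter.
have ut : uniq t by rewrite filter_uniq // window_uniq.
rewrite (perm_big _ (_ : perm_eq (window (N + L)) (window N ++ t))) /=;
  last first.
  apply: uniq_perm; first exact: window_uniq.
    rewrite cat_uniq window_uniq ut andbT /=; apply/negP => /hasP[k kt /=].
    by move: kt; rewrite tE => /andP[/negPf ->].
  move=> k; rewrite [RHS]mem_cat tE !mem_window.
  by case: k => i; case: ltnP => //= h; lia.
rewrite big_cat /= addrAC subrr add0r (le_trans (ler_normc_sum _ _ _)) //.
by apply: hN => // k; rewrite tE => /andP[].
Qed.

Lemma zsumP (f : int -> R[i]) M : sum_bounded (fun k => normc (f k)) M ->
  zcvg f (zsum f).
Proof. by move=> /zcvg_ex/(xgetPex 0). Qed.

Lemma zsum_eq (f : int -> R[i]) l : zcvg f l -> zsum f = l.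
Proof.
move=> fl; apply: (ccvg_unique _ _ _ _ fl).
by apply: (xgetPex 0); exists l.
Qed.

Lemma zcvgD (f g : int -> R[i]) a b : zcvg f a -> zcvg g b ->
  zcvg (fun k => f k + g k) (a + b).
Proof.
by move=> fa gb; apply: ccvg_ext (ccvgD _ _ _ _ fa gb) => N; rewrite big_split.
Qed.

Lemma zcvgZ (f : int -> R[i]) a c : zcvg f a -> zcvg (fun k => c * f k) (c * a).
Proof.
move=> fa; apply: ccvg_ext (ccvgM _ _ _ _ (ccvg_cst c) fa) => N.
by rewrite mulr_sumr.
Qed.

Lemma zcvg_delta (f : int -> R[i]) n : (forall k, k != n -> f k = 0) ->
  zcvg f (f n).
Proof.
move=> f0; have [N sN] := window_exhaust [:: n].
apply: dist_ccvg; apply: cvg_near_cst; exists N => // N' /= NN'.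
rewrite (bigD1_seq n) ?window_uniq //=; last by apply: (sN _ NN'); rewrite inE.
by rewrite big1 ?addr0 ?subrr ?normc0 // => k; exact: f0.
Qed.

(** A bound on all finite blocks passes to the full rows: for finitely many [n] the weighted sum is
    a limit of block sums over windows. *)
Lemma zcvg_rows (t : int -> int -> R[i]) (x : int -> R[i]) (p : int -> R) H :
  (forall n, zcvg (t n) (x n)) ->
  (forall r r', uniq r -> uniq r' ->
    \sum_(n <- r) p n * normc (\sum_(k <- r') t n k) ^+ 2 <= H) ->
  sum_bounded (fun n => p n * normc (x n) ^+ 2) H.
Proof.
move=> tx tH r ur.
have c : \sum_(n <- r) p n * normc (\sum_(k <- window N) t n k)
  ^+ 2 @[N --> \oo]
    --> \sum_(n <- r) p n * normc (x n) ^+ 2.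
  elim: r {ur} => [|n r IH].
    by rewrite big_nil; under eq_fun do rewrite big_nil; exact: cvg_cst.
  rewrite big_cons; under eq_fun do rewrite big_cons.
  by apply: cvgD => //; apply: cvgMr; exact: ccvg_sqr_normc (tx n).
rewrite -(cvg_lim _ c) //; apply: limr_le; first by apply/cvg_ex; eexists;
  exact: c.
by near=> N; apply: tH => //; exact: window_uniq.
Unshelve. all: by end_near. Qed.

(** Hilbert-Schmidt estimate from the weight [1 / p] to the weight [p], by Cauchy-Schwarz on each
    row for the products of [K * sqrt p] and [abs_sum / sqrt p]. With a summable [p] a bounded [K]
    is enough, which is the situation on the real axis. *)
Lemma hs_bound (t : int -> int -> R[i]) (x : int -> R[i]) (K : int -> int -> R)
    (p abs_sum : int -> R) H Phi :
  (forall n, 0 < p n) ->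
  (forall n k, normc (t n k) <= K n k * abs_sum k) ->
  (forall n, zcvg (t n) (x n)) ->
  (forall r r', uniq r -> uniq r' ->
    \sum_(n <- r) \sum_(k <- r') p n * (K n k ^+ 2 * p k) <= H) ->
  sum_bounded (fun k => abs_sum k ^+ 2 / p k) Phi ->
  sum_bounded (fun n => p n * normc (x n) ^+ 2) (H * Phi).
Proof.
move=> p0 tK tx KH pP; have P0 := sum_bounded_ge0 _ _ pP.
apply: zcvg_rows tx _ => r r' ur ur'.
apply: (@le_trans _ _ (\sum_(n <- r) (\sum_(k <- r') p n * (K n k ^+ 2 * p k))
  * Phi)); last first.
  by rewrite -mulr_suml ler_wpM2r // KH.
apply: ler_sum => n _; rewrite -mulr_sumr -mulrA ler_wpM2l ?(ltW (p0 n)) //.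
apply: (@le_trans _ _ ((\sum_(k <- r') K n k * abs_sum k) ^+ 2)).
  rewrite ler_pXn2r ?nnegrE ?normc_ge0 //.
    by rewrite (le_trans (ler_normc_sum _ _ _)) // ler_sum.
  by rewrite sumr_ge0 // => k _; exact: le_trans (normc_ge0 _) (tK n k).
have k0 k : 0 <= K n k ^+ 2 * p k by rewrite mulr_ge0 ?sqr_ge0 ?ltW.
apply: (@le_trans _ _ ((\sum_(k <- r') K n k ^+ 2 * p k) * (\sum_(k <- r')
  abs_sum k ^+ 2 / p k))).
  apply: sqr_sum_le => // k; first by rewrite divr_ge0 ?sqr_ge0 ?ltW.
  by rewrite le_eqVlt; apply/orP; left; apply/eqP; field; rewrite gt_eqF.
by rewrite ler_wpM2l ?pP // sumr_ge0.
Qed.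

(** Schur test: Cauchy-Schwarz on each row for the measure [K n k], after which the sums are
    exchanged and the column bound applies. *)
Lemma schur_bound (t : int -> int -> R[i]) (x : int -> R[i]) (K : int ->
  int -> R)
    (abs_sum : int -> R) S Phi :
  (forall n k, 0 <= K n k) ->
  (forall n k, normc (t n k) <= K n k * abs_sum k) ->
  (forall n, zcvg (t n) (x n)) ->
  (forall n, sum_bounded (K n) S) -> (forall k, sum_bounded (K ^~ k) S) ->
  sum_bounded (fun k => abs_sum k ^+ 2) Phi ->
  sum_bounded (fun n => normc (x n) ^+ 2) (S ^+ 2 * Phi).
Proof.
move=> K0 tK tx KS KS' pP; have P0 := sum_bounded_ge0 _ _ pP.
have S0 := sum_bounded_ge0 _ _ (KS 0).
suff : sum_bounded (fun n => 1 * normc (x n) ^+ 2) (S ^+ 2 * Phi).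
  by apply: sum_bounded_le => k; rewrite mul1r.
apply: zcvg_rows tx _ => r r' ur ur'.
apply: (@le_trans _ _ (\sum_(n <- r) S * (\sum_(k <- r')
  K n k * abs_sum k ^+ 2))); last first.
  rewrite -mulr_sumr expr2 -mulrA ler_wpM2l // exchange_big /=.
  apply: (@le_trans _ _ (\sum_(k <- r') S * abs_sum k ^+ 2)).
    by apply: ler_sum => k _; rewrite -mulr_suml ler_wpM2r ?sqr_ge0 // KS'.
  by rewrite -mulr_sumr ler_wpM2l // pP.
apply: ler_sum => n _; rewrite mul1r.
apply: (@le_trans _ _ ((\sum_(k <- r') K n k * abs_sum k) ^+ 2)).
  rewrite ler_pXn2r ?nnegrE ?normc_ge0 //.
    by rewrite (le_trans (ler_normc_sum _ _ _)) // ler_sum.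
  by rewrite sumr_ge0 // => k _; exact: le_trans (normc_ge0 _) (tK n k).
apply: (@le_trans _ _ ((\sum_(k <- r') K n k) * (\sum_(k <- r')
  K n k * abs_sum k ^+ 2))).
  apply: sqr_sum_le => // k; first by rewrite mulr_ge0 ?sqr_ge0.
  by rewrite exprMn expr2 mulrA.
by rewrite ler_wpM2r ?KS // sumr_ge0 // => k _; rewrite mulr_ge0 ?sqr_ge0.
Qed.

Lemma esum_zbnd f M : (forall k, 0 <= f k) ->
  (\esum_(k in [set: int]) (f k)%:E <= M%:E)%E <-> sum_bounded f M.
Proof.
move=> f0; split=> [h r ur|h].
  rewrite -lee_fin (le_trans _ h) //; apply: esum_ge; exists [set` r].
    by split => //; exact: finite_seq.
  by rewrite -sumEFin -fsbig_seq.
apply: ge_ereal_sup => _ [A [/finite_seqP[s ->] _] <-].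
rewrite (_ : [set` s] = [set` undup s]); last by apply/seteqP; split => k;
  rewrite /= mem_undup.
by rewrite -fsbig_seq ?undup_uniq // sumEFin lee_fin h // undup_uniq.
Qed.

End IntSums.

(** * Weighted spaces *)

Section Weights.
Context {R : realType}.
Implicit Types (f : int -> R) (M s : R).

Lemma sum_bounded_nat f M : (forall k, 0 <= f k) ->
  (forall N : nat, \sum_(0 <= i < N) (f (Posz i) + f (Negz i)) <= M) ->
    sum_bounded f M.
Proof.
move=> f0 fM r ur; have [N sN] := window_exhaust r.
rewrite (le_trans (ler_sum_subset _ _ _ f0 ur (window_uniq N)
  (sN N (leqnn N)))) //.
rewrite (le_trans _ (fM N)) // big_cat /= !big_map big_split /=.
by rewrite /index_iota subn0.
Qed.

Definition weight s (k : int) : R := (1 + `|k|%:~R) `^ (2 * s).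

Lemma weight_base_ge1 (k : int) : 1 <= 1 + `|k|%:~R :> R.
Proof. by rewrite lerDl ler0z. Qed.

Lemma weight_gt0 s k : 0 < weight s k.
Proof. by rewrite powR_gt0 // (lt_le_trans ltr01) // weight_base_ge1. Qed.

Lemma weightN s k : weight (- s) k = (weight s k)^-1.
Proof. by rewrite /weight mulrN powRN. Qed.

Lemma weight0 k : weight 0 k = 1.
Proof. by rewrite /weight mulr0 powRr0. Qed.

Lemma weight_ge1 s k : 0 <= s -> 1 <= weight s k.
Proof.
by move=> s0; rewrite -(weight0 k) ler_powR ?weight_base_ge1 // mulr0 mulr_ge0.
Qed.

(** Cauchy condensation. Two consecutive terms starting at the odd index [2 i + 1] are at most
    [2 f (2 i + 1) = q f i], so the partial sums satisfy [S_N <= S_(2N+1) <= 1 + q S_N] with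
    [q < 1]. *)
Lemma pseries_le (a : R) : 1 < a -> exists S, forall N : nat,
  \sum_(0 <= i < N) (1 + i%:R) `^ (- a) <= S :> R.
Proof.
move=> a1; pose f (i : nat) : R := (1 + i%:R) `^ (- a).
have f0 i : 0 <= f i by exact: powR_ge0.
pose q : R := 2 `^ (1 - a).
have q1 : q < 1.
  have h1 : (1 : R) `^ (a - 1) = 1 by rewrite powR1.
  rewrite /q -opprB powRN invf_lt1 ?powR_gt0 // -[ltLHS]h1.
  by rewrite gt0_ltr_powR ?nnegrE ?ltr1n // subr_gt0.
have fS i : f i.+1 <= f i.
  have b0 j : 0 < 1 + j%:R :> R by rewrite ltr_wpDr.
  rewrite /f !powRN lef_pV2 ?posrE ?powR_gt0 //.
  by rewrite ge0_ler_powR ?nnegrE ?addr_ge0 // ?lerD2l ?ler_nat //; lra.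
have f2 i : 2 * f (2 * i).+1 = q * f i.
  rewrite /f /q (_ : 1 + (2 * i).+1%:R = 2 * (1 + i%:R)); last first.
    by rewrite -natr1 natrM; ring.
  rewrite powRM ?addr_ge0 // mulrA; congr (_ * _).
  by rewrite powRD ?powRr1 // pnatr_eq0 implybT.
have step N : \sum_(0 <= i < (2 * N).+1) f i <= 1 + q * \sum_(0 <= i < N) f i.
  elim: N => [|N IH].
    by rewrite muln0 big_nat1 big_nil mulr0 addr0 /f addr0 powR1.
  rewrite [in leRHS]big_nat_recr //= mulrDr -f2 mulnS !addSn add0n.
  rewrite big_nat_recr //= big_nat_recr //=.
  have := fS (2 * N).+1; move: IH; lra.
exists (1 - q)^-1 => N; rewrite -/f.
have h : \sum_(0 <= i < N) f i <= \sum_(0 <= i < (2 * N).+1) f i.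
  rewrite [leRHS](@big_cat_nat _ _ _ N) /=; [|by lia..].
  by rewrite lerDl sumr_ge0.
rewrite -[leRHS]mul1r ler_pdivlMr ?subr_gt0 //; have := step N; lra.
Qed.

Lemma weight_summable s : 2^-1 < s -> exists P, sum_bounded (weight (- s)) P.
Proof.
move=> s1; have [S hS] := @pseries_le (2 * s) ltac:(lra).
exists (S + S); apply: sum_bounded_nat => [k|N];
  first exact: ltW (weight_gt0 _ _).
rewrite big_split /= lerD //.
  by rewrite (le_trans _ (hS N)) // ler_sum // => i _; rewrite /weight mulrN.
rewrite (le_trans _ (hS N)) // ler_sum // => i _; rewrite /weight mulrN !powRN.
have b0 j : 0 < 1 + j%:R :> R by rewrite ltr_wpDr.
(* [Negz i] is [- (i + 1)], so its term is the one of index [i + 1] in the series and can only be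
   smaller. *)
have e : 1 + `|Negz i|%:~R = 1 + i.+1%:R :> R by [].
rewrite e lef_pV2 ?posrE ?powR_gt0 //.
by rewrite ge0_ler_powR ?nnegrE ?addr_ge0 // ?lerD2l ?ler_nat //; lra.
Qed.

Lemma sum_bounded_geo (r : R) (n : int) : 0 <= r < 1 ->
  sum_bounded (fun k => r ^+ `|n - k|%N) (2 / (1 - r)).
Proof.
move=> /andP[r0 r1]; have g : sum_bounded (fun k : int => r ^+ `|k|%N)
  (2 / (1 - r)).
  have S N : \sum_(0 <= i < N) r ^+ i <= (1 - r)^-1.
    rewrite -[leRHS]mul1r ler_pdivlMr ?subr_gt0 //.
    have -> : (\sum_(0 <= i < N) r ^+ i) * (1 - r) = 1 - r ^+ N.
      elim: N => [|N IH]; first by rewrite big_nil mul0r expr0 subrr.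
      by rewrite big_nat_recr //= mulrDl IH exprS; ring.
    by rewrite lerBlDr lerDl exprn_ge0.
  apply: sum_bounded_nat => [k|N]; first exact: exprn_ge0.
  rewrite big_split /= mulr_natl mulr2n lerD // (le_trans _ (S N)) //.
  apply: ler_sum => i _; rewrite exprS ler_piMl ?exprn_ge0 //; lra.
by apply: (sum_bounded_inj _ _ (fun k => n - k) _ g) => x y; lia.
Qed.

Definition density (w : spinor R) (k : int) : R :=
  normc (upper w k) ^+ 2 + normc (lower w k) ^+ 2.

Lemma density_ge0 w k : 0 <= density w k.
Proof. by rewrite addr_ge0 ?sqr_ge0. Qed.

Lemma l2_normP s (w : spinor R) M : 0 <= M ->
  (l2_norm s w <= M%:E)%E <-> sum_bounded (fun k => weight s k * density w k)
    (M ^+ 2).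
Proof.
move=> M0; rewrite -esum_zbnd; last first.
  by move=> k; rewrite mulr_ge0 ?density_ge0 ?(ltW (weight_gt0 _ _)).
have e0 (u : int -> R[i]) k : (0 <= ((weight s k) * normc (u k) ^+ 2)%:E)%E.
  by rewrite lee_fin mulr_ge0 ?sqr_ge0 ?(ltW (weight_gt0 _ _)).
have E0 (u : int -> R[i]) : (0 <= \esum_(k in [set: int]) ((weight s k)
  * normc (u k) ^+ 2)%:E)%E.
  by apply: esum_ge0.
rewrite /l2_norm /ell2_norm !sqr_sqrte; try exact: E0.
rewrite -esumD //; last by move=> *; exact: e0.
  rewrite (_ : M%:E = sqrte (M ^+ 2)%:E); last first.
    by rewrite EFin_expe sqrte_sqr /= ger0_norm.
  rewrite lee_sqrt ?lee_fin ?sqr_ge0 //.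
  by under eq_esum do rewrite -EFinD -mulrDr.
by move=> *; exact: e0.
Qed.

Lemma l2P s (w : spinor R) :
  l2 s w <-> exists M, sum_bounded (fun k => weight s k * density w k) M.
Proof.
split=> [|[M wM]].
  rewrite /l2 /= => h; exists (fine (l2_norm s w) ^+ 2).
  have h0 : (0 <= l2_norm s w)%E by exact: sqrte_ge0.
  apply/l2_normP; first exact: fine_ge0.
  by rewrite fineK // ge0_fin_numE.
have M0 := sum_bounded_ge0 _ _ wM.
rewrite /l2 /= (@le_lt_trans _ _ (Num.sqrt M)%:E) ?ltry //.
by apply/l2_normP; rewrite ?sqrtr_ge0 // sqr_sqrtr.
Qed.

End Weights.

(** * Jost solutions *)

(* The rows of [D - z] at site [n] are [al n u_n + pc n v_n - v_(n+1)] and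
   [pc n u_n - u_(n-1) + be n v_n]; [al0], [be0] (and 1) are the coefficients
   without potential, and [th], [th^-1] the eigenvalues of the free transfer
   matrix. *)
Record dirac_data (R : realType) := DiracData {
  al : int -> R[i]; be : int -> R[i]; pc : int -> R[i];
  al0 : R[i]; be0 : R[i]; th : R[i] }.
Arguments al {R}. Arguments be {R}. Arguments pc {R}.
Arguments al0 {R}. Arguments be0 {R}. Arguments th {R}.

Section Jost.
Context {R : realType}.
Implicit Types (d : dirac_data R) (x y : R[i] * R[i]) (n : int) (N M : nat).

Definition slope_plus d := (1 - th d) / be0 d.
Definition slope_minus d := (1 - (th d)^-1) / be0 d.
Local Notation sp := slope_plus.
Local Notation sm := slope_minus.

(* One step of the transfer matrix on [(u_(n-1), v_n)], multiplied by [th]. *)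
Definition step d n x : R[i] * R[i] :=
  let u := (x.1 - be d n * x.2) / pc d n in
  (th d * u, th d * (pc d n * x.2 + al d n * u)).

Definition step0 d x : R[i] * R[i] :=
  let u := x.1 - be0 d * x.2 in (th d * u, th d * (x.2 + al0 d * u)).

(** Transports the state [x] from [n - N] to [n], so that increasing [N] moves the starting point
    towards -oo. *)
Fixpoint steps d n N x : R[i] * R[i] :=
  if N is N'.+1 then step d (n - 1) (steps d (n - 1) N' x) else x.

(* The two summands are, up to a factor, the coordinates in the eigenbasis
   [(1, slope_minus)], [(1, slope_plus)] of [step0], of eigenvalues 1, [th^2]. *)
Definition jost_norm d x : R :=
  normc (x.2 - sp d * x.1) + normc (x.2 - sm d * x.1).

(* [entry11] to [entry22] compare the transfer matrix with the free one; up to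
   signs, they are permuted by the exchange of [al] and [be]. *)
Record admissible d (L : R) (kap : int -> R) : Prop := Admissible {
  be0_neq0 : be0 d != 0; th_neq0 : th d != 0;
  pc_neq0 : forall n, pc d n != 0;
  th_le1 : normc (th d) <= 1;
  trace_eq : th d + (th d)^-1 = 2 - al0 d * be0 d;
  sm_neq_sp : sm d - sp d != 0;
  L_ge1 : 1 <= L;
  sp_le : normc (sp d) <= L; sm_le : normc (sm d) <= L;
  slope_gap : (normc (sm d - sp d))^-1 <= L;
  thV_le : normc (th d)^-1 <= L;
  entry11 : forall n, normc ((pc d n)^-1 - 1) <= kap n;
  entry12 : forall n, normc (be d n / pc d n - be0 d) <= kap n;
  entry21 : forall n, normc (al d n / pc d n - al0 d) <= kap n;
  entry22 : forall n, normc (pc d n - al d n * be d n / pc d n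
    - (1 - al0 d * be0 d)) <= kap n }.

(** [(1, slope_minus)] is fixed by [step0]; launching it ever further to the left yields the Jost
    solution with its free factor [th^(-n)] removed. *)
Definition jost d n : R[i] * R[i] :=
  (xget 0 (ccvg \oo (fun N => (steps d n N (1, sm d)).1)),
   xget 0 (ccvg \oo (fun N => (steps d n N (1, sm d)).2))).

Lemma jost_norm_ge0 d x : 0 <= jost_norm d x.
Proof. by rewrite addr_ge0 ?normc_ge0. Qed.

Lemma jost_normD d x y : jost_norm d (x + y) <= jost_norm d x + jost_norm d y.
Proof.
rewrite /jost_norm /= addrACA.
rewrite (_ : _ - sp d * _ = x.2 - sp d * x.1 + (y.2 - sp d * y.1));
  last by ring.
rewrite (_ : _ - sm d * (_ + _) = x.2 - sm d * x.1 + (y.2 - sm d * y.1));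
  last by ring.
by rewrite lerD ?normcD.
Qed.

Lemma step_sub d n x y : step d n (x - y) = step d n x - step d n y.
Proof. by rewrite /step /=; congr pair; rewrite /=; ring. Qed.

Lemma steps_sub d n N x y : steps d n N (x - y) = steps d n N x - steps d n N y.
Proof. by elim: N n x y => //= N IH n x y; rewrite IH step_sub. Qed.

Lemma steps_cat d n N M x :
  steps d n (N + M) x = steps d n N (steps d (n - N%:Z) M x).
Proof.
elim: N n => [|N IH] n /=; first by rewrite subr0.
by rewrite IH; congr (step _ _ (steps _ _ _ (steps _ _ _ _))); lia.
Qed.

Section admissible.
Context {d : dirac_data R} {L : R} {kap : int -> R} (A : admissible d L kap).

Let e : R[i] * R[i] := (1, sm d).
(** [1 + L + L^2] is the cost of passing from [jost_norm] to the two components, [2 (1 + L)] the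
    cost of passing back. *)
Let growth : R := 2 * (1 + L) * (1 + L + L ^+ 2).

Lemma entry_bound_ge0 n : 0 <= kap n.
Proof. exact: le_trans (normc_ge0 _) (entry11 _ _ _ A n). Qed.

Lemma slope_bound_ge0 : 0 <= L. Proof. exact: le_trans ler01 (L_ge1 _ _ _ A).
  Qed.

Lemma growth_ge0 : 0 <= growth.
Proof. by have := slope_bound_ge0 => L0;
  rewrite !mulr_ge0 ?addr_ge0 ?exprn_ge0. Qed.

Lemma al0E : al0 d = (2 - th d - (th d)^-1) / be0 d.
Proof.
have := trace_eq _ _ _ A => h; apply: (mulIf (be0_neq0 _ _ _ A)).
rewrite divfK ?(be0_neq0 _ _ _ A) // -addrA -opprD h; ring.
Qed.

Lemma step0_e : step0 d e = e.
Proof.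
have b0 := be0_neq0 _ _ _ A; have t0 := th_neq0 _ _ _ A.
by rewrite /step0 /e /= al0E /sm; congr pair; field; rewrite b0 t0.
Qed.

Lemma jost_norm_step0 x : jost_norm d (step0 d x) <= jost_norm d x.
Proof.
have b0 := be0_neq0 _ _ _ A; have t0 := th_neq0 _ _ _ A.
rewrite /jost_norm /step0 /= al0E.
set u := x.1; set v := x.2.
rewrite (_ : _ - sp d * (th d * _) = v - sp d * u); last first.
  by rewrite /sp; field; rewrite b0 t0.
rewrite (_ : _ - sm d * (th d * _) = th d ^+ 2 * (v - sm d * u)); last first.
  by rewrite /sm; field; rewrite b0 t0.
rewrite lerD2l normcM normcX ler_piMl ?normc_ge0 //.
by rewrite exprn_ile1 ?normc_ge0 // (th_le1 _ _ _ A).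
Qed.

Lemma fst_le x : normc x.1 <= L * jost_norm d x.
Proof.
have g := slope_gap _ _ _ A; have ne := sm_neq_sp _ _ _ A.
have -> : x.1 = (sm d - sp d)^-1 *
    ((x.2 - sp d * x.1) - (x.2 - sm d * x.1)) by field.
rewrite normcM normcV ler_pM ?normc_ge0 ?invr_ge0 ?normc_ge0 //.
exact: normcB.
Qed.

Lemma snd_le x : normc x.2 <= (1 + L ^+ 2) * jost_norm d x.
Proof.
have L0 := slope_bound_ge0.
have -> : x.2 = (x.2 - sp d * x.1) + sp d * x.1 by ring.
rewrite (le_trans (normcD _ _)) // mulrDl mul1r lerD //.
  by rewrite lerDl normc_ge0.
by rewrite normcM expr2 -mulrA ler_pM ?normc_ge0 ?(sp_le _ _ _ A) ?fst_le.
Qed.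

Lemma jost_norm_step_diff n x : jost_norm d (step d n x - step0 d x)
  <= growth * kap n * jost_norm d x.
Proof.
have k0 := entry_bound_ge0 n; have p0 := pc_neq0 _ _ _ A n.
have L0 := slope_bound_ge0; have n0 := jost_norm_ge0 d x.
have t1 := th_le1 _ _ _ A; have t0 := normc_ge0 (th d).
pose B := kap n * ((1 + L + L ^+ 2) * jost_norm d x).
have hB a b : normc a <= kap n -> normc b <= kap n ->
    normc (th d * (a * x.1 + b * x.2)) <= B.
  move=> ha hb; rewrite normcM -[leRHS]mul1r ler_pM ?normc_ge0 //.
  rewrite (le_trans (normcD _ _)) // !normcM.
  have h1 := ler_pM (normc_ge0 a) (normc_ge0 x.1) ha (fst_le x).
  have h2 := ler_pM (normc_ge0 b) (normc_ge0 x.2) hb (snd_le x).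
  by move: h1 h2; rewrite /B; lra.
have B1 : normc (step d n x - step0 d x).1 <= B.
  rewrite (_ : _.1 = th d * (((pc d n)^-1 - 1) * x.1 +
    - (be d n / pc d n - be0 d) * x.2)); last by rewrite /=; field.
  by apply: hB; [exact: entry11 A n | rewrite normcN; exact: entry12 A n].
have B2 : normc (step d n x - step0 d x).2 <= B.
  rewrite (_ : _.2 = th d * ((al d n / pc d n - al0 d) * x.1 +
    (pc d n - al d n * be d n / pc d n - (1 - al0 d * be0 d)) * x.2)).
    by apply: hB; [exact: entry21 A n | exact: entry22 A n].
  by rewrite /=; field.
rewrite [leLHS]/jost_norm; move: (step d n x - step0 d x) B1 B2 => y B1 B2.
have h s : normc s <= L -> normc (y.2 - s * y.1) <= (1 + L) * B.
  move=> hs; rewrite (le_trans (normcB _ _)) // normcM mulrDl mul1r lerD //.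
  by rewrite ler_pM ?normc_ge0.
have := h _ (sp_le _ _ _ A); have := h _ (sm_le _ _ _ A).
rewrite /B /growth; lra.
Qed.

Lemma jost_norm_step n x : jost_norm d (step d n x) <= (1 + growth * kap n)
  * jost_norm d x.
Proof.
rewrite (_ : step d n x = step0 d x + (step d n x - step0 d x)); last first.
  by rewrite addrC subrK.
rewrite (le_trans (jost_normD _ _ _)) // mulrDl mul1r lerD ?jost_norm_step0 //.
exact: jost_norm_step_diff.
Qed.

Definition backward_sum (f : int -> R) n N :=
  \sum_(0 <= i < N) f (n - 1 - i%:Z).

Lemma backward_sumS f n N : backward_sum f n N.+1 = f (n - 1)
  + backward_sum f (n - 1) N.
Proof.
rewrite /backward_sum big_nat_recl //= subr0; congr (_ + _).
by apply: eq_bigr => i _; congr f; lia.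
Qed.

Lemma jost_norm_steps n N x :
  jost_norm d (steps d n N x) <= expR (growth * backward_sum kap n N)
    * jost_norm d x.
Proof.
elim: N n => [|N IH] n; first by rewrite /backward_sum big_nil mulr0 expR0
  mul1r.
rewrite /= (le_trans (jost_norm_step _ _)) // backward_sumS (mulrDr growth)
  expRD -mulrA.
rewrite ler_pM ?expR_ge1Dx ?jost_norm_ge0 ?IH //.
by rewrite addr_ge0 // mulr_ge0 ?growth_ge0 ?entry_bound_ge0.
Qed.

Context {K : R} (kapK : sum_bounded kap K).
Let E : R := expR (growth * K).

Lemma backward_sum_le n N : backward_sum kap n N <= K.
Proof.
rewrite /backward_sum -(big_map (fun i : nat => n - 1 - i%:Z) predT) kapK //.
by rewrite map_inj_uniq ?iota_uniq // => i j; lia.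
Qed.

Lemma jost_norm_steps_le n N x : jost_norm d (steps d n N x)
  <= E * jost_norm d x.
Proof.
rewrite (le_trans (jost_norm_steps _ _ _))
  // ler_wpM2r ?jost_norm_ge0 // ler_expR.
by rewrite ler_wpM2l ?growth_ge0 // backward_sum_le.
Qed.

Lemma jost_norm_e : jost_norm d e <= 2 * L.
Proof.
rewrite /jost_norm /e /= !mulr1 subrr normc0 addr0 (le_trans (normcB _ _)) //.
by have := sp_le _ _ _ A; have := sm_le _ _ _ A; lra.
Qed.

Let C : R := growth * (E * (2 * L)).

Lemma steps_const_ge0 : 0 <= E. Proof. exact: expR_ge0. Qed.

Lemma steps_near_const_ge0 : 0 <= C.
Proof. by apply: mulr_ge0 growth_ge0 _; apply: mulr_ge0 steps_const_ge0 _;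
  apply: mulr_ge0 slope_bound_ge0. Qed.

(** Since [step0] fixes [e], each step contributes only its perturbation, at most [growth * kap]
    times the uniform bound [E * (2 * L)] on the orbit, and [step0] does not amplify the error
    collected before. *)
Lemma steps_near n N : jost_norm d (steps d n N e - e)
  <= C * backward_sum kap n N.
Proof.
elim: N n => [|N IH] n.
  rewrite /backward_sum big_nil mulr0 /= subrr /jost_norm /= !mulr0 subrr
    normc0.
  by rewrite addr0.
rewrite /= backward_sumS mulrDr -{2}step0_e.
set y := steps d (n - 1) N e.
rewrite (_ : _ - _ = (step d (n - 1) y - step0 d y) + step0 d (y - e));
  last first.
  by rewrite /step0 /=; congr pair; rewrite /=; ring.
rewrite (le_trans (jost_normD _ _ _)) // lerD //.
  rewrite (le_trans (jost_norm_step_diff _ _)) // /C -mulrA -[leRHS]mulrA.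
  rewrite ler_wpM2l ?growth_ge0 // [leRHS]mulrC ler_wpM2l ?entry_bound_ge0 //.
  by rewrite (le_trans (jost_norm_steps_le _ _ _))
    // ler_wpM2l ?steps_const_ge0 ?jost_norm_e.
by rewrite (le_trans (jost_norm_step0 _)) // IH.
Qed.

(** Launching [M] sites further left changes the state at [n - N] by a tail of [kap], and the
    remaining [N] steps amplify the change by at most [E]. *)
Lemma steps_cauchy n N M :
  jost_norm d (steps d n (N + M) e - steps d n N e)
    <= E * (C * backward_sum kap (n - N%:Z) M).
Proof.
rewrite steps_cat -steps_sub (le_trans (jost_norm_steps_le _ _ _)) //.
by rewrite ler_wpM2l ?steps_const_ge0 ?steps_near.
Qed.

Lemma backward_tail eta : 0 < eta -> exists m : int, forall n, n <= m ->
  forall M, backward_sum kap n M <= eta.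
Proof.
move=> /(sum_bounded_tail _ _ entry_bound_ge0 kapK)[N0 hN0].
exists (- (N0%:Z)) => n nm M.
rewrite /backward_sum -(big_map (fun i : nat => n - 1 - i%:Z) predT) hN0 //.
  by rewrite map_inj_uniq ?iota_uniq // => i j; lia.
move=> _ /mapP[i _ ->]; rewrite mem_window; case h : (n - 1 - i%:Z) => [j|j];
  lia.
Qed.

(** The bound involves only [L], [kap] and [K], so the [N] found here serves all data admissible
    with the same constants. *)
Lemma steps_fine n eta : 0 < eta -> exists N, forall M,
  E * (C * backward_sum kap (n - N%:Z) M) <= eta.
Proof.
move=> eta0; have EC : 0 <= E * C by rewrite mulr_ge0 ?steps_const_ge0
  ?steps_near_const_ge0.
have [m hm] := backward_tail (eta / (1 + E * C))
  ltac:(rewrite divr_gt0 // ltr_wpDr //).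
exists `|n - m|%N => M; rewrite mulrA.
apply: (@le_trans _ _ (E * C * (eta / (1 + E * C)))).
  by rewrite ler_wpM2l // hm //; lia.
rewrite mulrA ler_pdivrMr ?ltr_wpDr // mulrC ler_pM2l //; lra.
Qed.

Lemma jost_cvg n :
  ccvg \oo (fun N => (steps d n N e).1) (jost d n).1 /\
  ccvg \oo (fun N => (steps d n N e).2) (jost d n).2.
Proof.
have k (p : R[i] * R[i] -> R[i]) (B : R) : 0 <= B ->
    (forall x y, p x - p y = p (x - y)) ->
    (forall x, normc (p x) <= B * jost_norm d x) ->
    exists l, ccvg \oo (fun N => p (steps d n N e)) l.
  move=> B0 pD pB; apply: ccvg_cauchy => eta eta0.
  have [N hN] := steps_fine n (eta / (1 + B))
    ltac:(rewrite divr_gt0 // ltr_wpDr //).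
  exists N => M; rewrite pD (le_trans (pB _)) //.
  apply: (@le_trans _ _ (B * (eta / (1 + B)))).
    by rewrite ler_wpM2l // (le_trans (steps_cauchy _ _ _)).
  rewrite mulrA ler_pdivrMr ?ltr_wpDr // mulrC ler_pM2l //; lra.
by split; apply: (xgetPex 0); [apply: (k fst) fst_le | apply: (k snd) snd_le];
  rewrite // ?addr_ge0 ?exprn_ge0 ?slope_bound_ge0.
Qed.

Lemma jost_norm_limit (f : nat -> R[i] * R[i]) l a B :
  ccvg \oo (fun N => (f N).1) l.1 -> ccvg \oo (fun N => (f N).2) l.2 ->
  (\forall N \near \oo, jost_norm d (f N - a) <= B) -> jost_norm d (l - a) <= B.
Proof.
move=> f1 f2 fB.
have h s : normc ((f N).2 - a.2 - s * ((f N).1 - a.1)) @[N --> \oo]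
    --> normc (l.2 - a.2 - s * (l.1 - a.1)).
  apply: ccvg_normc; apply: ccvgB.
    by apply: ccvgB => //; exact: ccvg_cst.
  apply: ccvgM; first exact: ccvg_cst.
  by apply: ccvgB => //; exact: ccvg_cst.
have hs : normc ((f N).2 - a.2 - sp d * ((f N).1 - a.1)) +
    normc ((f N).2 - a.2 - sm d * ((f N).1 - a.1)) @[N --> \oo] -->
    normc (l.2 - a.2 - sp d * (l.1 - a.1))
      + normc (l.2 - a.2 - sm d * (l.1 - a.1)).
  by apply: cvgD; exact: h.
rewrite [jost_norm _ _](_ : _ = normc (l.2 - a.2 - sp d * (l.1 - a.1)) +
  normc (l.2 - a.2 - sm d * (l.1 - a.1))) //.
rewrite -(cvg_lim _ hs) //; apply: limr_le => //.
by apply/cvg_ex; eexists; exact: hs.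
Qed.

Lemma jost_approx n N tau :
  (forall M, E * (C * backward_sum kap (n - N%:Z) M) <= tau) ->
  jost_norm d (jost d n - steps d n N e) <= tau.
Proof.
move=> h; have [c1 c2] := jost_cvg n; apply: jost_norm_limit c1 c2 _.
exists N => // M /= NM; rewrite -(subnKC NM).
by rewrite (le_trans (steps_cauchy _ _ _)).
Qed.

Lemma jost_bound n : jost_norm d (jost d n) <= E * (2 * L).
Proof.
have [c1 c2] := jost_cvg n; rewrite -[jost d n]subr0.
apply: jost_norm_limit c1 c2 _; near=> N; rewrite subr0.
by rewrite (le_trans (jost_norm_steps_le _ _ _))
  // ler_wpM2l ?steps_const_ge0 ?jost_norm_e.
Unshelve. all: by end_near. Qed.

Lemma jost_step n : jost d (n + 1) = step d n (jost d n).
Proof.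
have [c1 c2] := jost_cvg n; have [c1' c2'] := jost_cvg (n + 1).
have s1 (f : nat -> R[i]) l : ccvg \oo f l -> ccvg \oo (fun N => f N.+1) l.
  by move=> [f1 f2]; split; [rewrite -cvg_shiftS in f1 | rewrite -cvg_shiftS in
    f2].
have u : ccvg \oo (fun N => ((steps d n N e).1 - be d n * (steps d n N e).2)
  / pc d n)
    (((jost d n).1 - be d n * (jost d n).2) / pc d n).
  apply: ccvgM; last exact: ccvg_cst.
  by apply: ccvgB => //; apply: ccvgM => //; exact: ccvg_cst.
rewrite [LHS]surjective_pairing [RHS]surjective_pairing; congr pair.
  apply: (ccvg_unique _ _ _ (s1 _ _ c1')).
  rewrite /= addrK; apply: ccvgM => //; exact: ccvg_cst.
apply: (ccvg_unique _ _ _ (s1 _ _ c2')).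
rewrite /= addrK; apply: ccvgM; first exact: ccvg_cst.
by apply: ccvgD; apply: ccvgM => //; exact: ccvg_cst.
Qed.

Lemma jost_asymp eta : 0 < eta -> exists m : int, forall n, n <= m ->
  jost_norm d (jost d n - e) <= eta.
Proof.
move=> eta0; have EC : 0 <= E * C by rewrite mulr_ge0 ?steps_const_ge0
  ?steps_near_const_ge0.
have [m hm] := backward_tail (eta / (1 + E * C))
  ltac:(rewrite divr_gt0 // ltr_wpDr //).
(* With [N = 0] the truncated product is [e] itself, and the truncation error is the whole tail to
   the left of [n]. *)
exists m => n nm; apply: (jost_approx _ 0%N) => M; rewrite subr0 mulrA.
apply: (@le_trans _ _ (E * C * (eta / (1 + E * C)))).
  by rewrite ler_wpM2l // hm.
rewrite mulrA ler_pdivrMr ?ltr_wpDr // mulrC ler_pM2l //; lra.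
Qed.

End admissible.
End Jost.

(** * Flux and Wronskian *)

Section Solutions.
Context {R : realType}.
Implicit Types (d : dirac_data R) (u v f g : int -> R[i]) (n k : int) (c : R).
Local Notation cIm := complex.Im.

Lemma int_step_const (T : Type) (F : int -> T) : (forall n, F (n + 1) = F n) ->
  forall n, F n = F 0.
Proof.
move=> FS; have up n (N : nat) : F (n + N%:Z) = F n.
  elim: N => [|N IH]; first by rewrite addr0.
  by rewrite -addn1 PoszD addrA FS.
case=> N; first by rewrite -[Posz N]add0r up.
by rewrite NegzE -[RHS](congr1 F (addNr N.+1%:Z)) up.
Qed.

Lemma int_step_antitone (F : int -> R) : (forall n, F (n + 1) <= F n) ->
  forall k n, k <= n -> F n <= F k.
Proof.
move=> FS k n kn; have -> : n = k + `|n - k|%N by lia.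
elim: `|n - k|%N => [|N IH]; first by rewrite addr0.
by rewrite -addn1 PoszD addrA (le_trans (FS _)).
Qed.

Definition sol d u v := forall n,
  pc d n * u n - u (n - 1) + be d n * v n = 0 /\
  al d n * u n + pc d n * v n - v (n + 1) = 0.

(** The state [(u_(n-1), v_n)] is [th^(-n)] times [jost d n], hence the shifted index in this
    component. *)
Definition left_u d n : R[i] := th d ^ (- (n + 1)) * (jost d (n + 1)).1.
Definition left_v d n : R[i] := th d ^ (- n) * (jost d n).2.

Definition mirror d := DiracData R (fun n => be d (- n)) (fun n => al d (- n))
  (fun n => pc d (- n)) (be0 d) (al0 d) (th d).

Definition right_u d n := left_v (mirror d) (- n).
Definition right_v d n := left_u (mirror d) (- n).

Definition wronskian u v u' v' n := u (n - 1) * v' n - u' (n - 1) * v n.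
Definition jost_wronskian d := wronskian (right_u d) (right_v d) (left_u d)
  (left_v d) 0.

Lemma sol_back d u v n : sol d u v -> u (n - 1) = pc d n * u n + be d n * v n.
Proof.
move=> /(_ n)[h _]; apply/eqP; rewrite eq_sym -subr_eq0 -h; apply/eqP; ring.
Qed.

Lemma sol_next d u v n : sol d u v -> v (n + 1) = al d n * u n + pc d n * v n.
Proof. by move=> /(_ n)[_ h]; apply/eqP; rewrite eq_sym -subr_eq0 h. Qed.

(** The form in which the Wronskian appears as the jump of the Green kernel on the diagonal. *)
Lemma wronskian_local d u v u' v' n : sol d u v -> sol d u' v' ->
  wronskian u v u' v' n = pc d n * (u n * v' n - u' n * v n).
Proof. by move=> s s'; rewrite /wronskian !(sol_back d _ _ n s,
  sol_back d _ _ n s'); ring. Qed.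

Lemma wronskian_const d u v u' v' : sol d u v -> sol d u' v' ->
  forall n, wronskian u v u' v' n = wronskian u v u' v' 0.
Proof.
move=> s s'; apply: int_step_const => n.
rewrite (wronskian_local d _ _ _ _ n s s') /wronskian addrK.
rewrite !(sol_next d _ _ n s, sol_next d _ _ n s'); ring.
Qed.

Lemma sol_mirror d u v : sol (mirror d) u v ->
  sol d (fun n => v (- n)) (fun n => u (- n)).
Proof.
move=> s n; have [/= h1 h2] := s (- n); move: h1 h2.
rewrite !opprK => h1 h2; split.
  rewrite -h2 (_ : - (n - 1) = - n + 1); [ring | lia].
by rewrite -h1 (_ : - (n + 1) = - n - 1); [ring | lia].
Qed.

(* [cxy n k] is the response of the component [x] at [n] to a source in the
   component [y] at [k]. In the order [v_n, u_n, v_(n+1), u_(n+1)] of the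
   unknowns the Dirac operator is a Jacobi matrix, hence the asymmetry between
   the tests [k <= n] and [k < n]. *)
Definition cuu d n k : R[i] := (jost_wronskian d)^-1 *
  (if k <= n then right_u d n * left_u d k else left_u d n * right_u d k).
Definition cuv d n k : R[i] := (jost_wronskian d)^-1 *
  (if k <= n then right_u d n * left_v d k else left_u d n * right_v d k).
Definition cvu d n k : R[i] := (jost_wronskian d)^-1 *
  (if k < n then right_v d n * left_u d k else left_v d n * right_u d k).
Definition cvv d n k : R[i] := (jost_wronskian d)^-1 *
  (if k < n then right_v d n * left_v d k else left_v d n * right_v d k).

Definition kernel_upper d (w : spinor R) n k : R[i] :=
  cuu d n k * upper w k + cuv d n k * lower w k.
Definition kernel_lower d (w : spinor R) n k : R[i] :=
  cvu d n k * upper w k + cvv d n k * lower w k.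

(** Off the diagonal all three terms lie on the same branch of the kernel, which is a solution in
    [n]. For [k = n] the branches mix, and their difference is the local Wronskian, cancelled by the
    prefactor. *)
Lemma green_eq1 d w n k : sol d (left_u d) (left_v d) ->
  sol d (right_u d) (right_v d) ->
  jost_wronskian d != 0 ->
  al d n * kernel_upper d w n k + pc d n * kernel_lower d w n k - kernel_lower d
    w (n + 1) k =
  if k == n then upper w n else 0.
Proof.
move=> sl sr W0; rewrite /kernel_upper /kernel_lower /cuu /cuv /cvu /cvv ltzD1.
rewrite (sol_next d _ _ n sl) (sol_next d _ _ n sr).
case: (ltgtP k n) => [kn|kn|->]; [ring | ring |].
have := wronskian_local d _ _ _ _ n sr sl;
  rewrite (wronskian_const d _ _ _ _ sr sl) -/(jost_wronskian d) => hW.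
transitivity ((jost_wronskian d)^-1 * (jost_wronskian d * upper w n));
  last by rewrite mulKf.
by rewrite [X in _ = _ * (X * _)]hW; ring.
Qed.

Lemma green_eq2 d w n k : sol d (left_u d) (left_v d) ->
  sol d (right_u d) (right_v d) ->
  jost_wronskian d != 0 ->
  pc d n * kernel_upper d w n k - kernel_upper d w (n - 1)
    k + be d n * kernel_lower d w n k =
  if k == n then lower w n else 0.
Proof.
move=> sl sr W0; rewrite /kernel_upper /kernel_lower /cuu /cuv /cvu /cvv.
rewrite (_ : (k <= n - 1) = (k < n)); last by lia.
rewrite (sol_back d _ _ n sl) (sol_back d _ _ n sr).
case: (ltgtP k n) => [kn|kn|->]; [ring | ring |].
have := wronskian_local d _ _ _ _ n sr sl;
  rewrite (wronskian_const d _ _ _ _ sr sl) -/(jost_wronskian d) => hW.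
transitivity ((jost_wronskian d)^-1 * (jost_wronskian d * lower w n));
  last by rewrite mulKf.
by rewrite [X in _ = _ * (X * _)]hW; ring.
Qed.

Definition flux u v n : R := cIm (conjc (u (n - 1)) * v n).
(** Coefficients of a real operator minus a spectral parameter of imaginary part [c]. *)
Definition selfadj d c := forall n,
  [/\ cIm (al d n) = - c, cIm (be d n) = - c & cIm (pc d n) = 0].

Lemma flux_step d c u v n : selfadj d c -> sol d u v ->
  flux u v (n + 1) = flux u v n - c * (normc (u n) ^+ 2 + normc (v n) ^+ 2).
Proof.
move=> sa s; have [] := sa n.
rewrite /flux addrK (sol_next d _ _ n s) (sol_back d _ _ n s) !normc_sqr.
case: (al d n) (be d n) (pc d n) (u n) (v n) => [a a'] [b b'] [p p'] [x x']
  [y y'].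
by rewrite /= => -> -> ->; ring.
Qed.

Lemma flux_le u v n : `|flux u v n| <= normc (u (n - 1)) * normc (v n).
Proof. by rewrite (le_trans (Im_le_normc _)) // normcM normc_conj. Qed.

(** [c * flux] is nonincreasing in [n] and tends to 0 at -oo, so it is nonpositive at [k]; crossing
    the single site [k] already produces the stated loss. *)
Lemma flux_left d c u v : selfadj d c -> sol d u v ->
  (forall eta, 0 < eta -> exists m : int, forall n, n <= m ->
     normc (u (n - 1)) * normc (v n) <= eta) ->
  forall k n, k < n ->
    c * flux u v n <= - (c ^+ 2 * (normc (u k) ^+ 2 + normc (v k) ^+ 2)).
Proof.
move=> sa s dec k n kn; pose j n := c * flux u v n.
have jS i : j (i + 1) = j i - c ^+ 2 * (normc (u i) ^+ 2 + normc (v i) ^+ 2).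
  by rewrite /j (flux_step d c) //; ring.
have ja := int_step_antitone j (fun i => _ : j (i + 1) <= j i).
have {}ja : forall k n, k <= n -> j n <= j k.
  apply: ja => i; rewrite jS lerBlDr lerDl mulr_ge0 ?sqr_ge0 //.
  by rewrite addr_ge0 ?sqr_ge0.
have j0 i : j i <= 0.
  apply/ler_addgt0Pl => eta eta0; rewrite addr0.
  have c0 : 0 < 1 + `|c| by rewrite ltr_wpDr.
  have [m hm] := dec (eta / (1 + `|c|)) (divr_gt0 eta0 c0).
  pose i' := if i <= m then i else m.
  have [i'm i'i] : i' <= m /\ i' <= i by rewrite /i'; case: (leP i m) => ?; lia.
  rewrite (le_trans (ja _ _ i'i)) // (le_trans (ler_norm _)) // /j normrM.
  have h := le_trans (flux_le u v i') (hm _ i'm).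
  rewrite (le_trans (ler_wpM2l _ h)) // mulrA ler_pdivrMr // mulrC ler_pM2l //;
    lra.
have k1 : k + 1 <= n by lia.
by rewrite (le_trans (ja _ _ k1)) // jS; have := j0 k; lra.
Qed.

Lemma flux_right d c u v : selfadj d c -> sol d u v ->
  (forall eta, 0 < eta -> exists m : int, forall n, m <= n ->
     normc (u n) * normc (v (n + 1)) <= eta) ->
  forall n, 0 <= c * flux u v n.
Proof.
move=> sa s dec n; pose j n := c * flux u v n.
have ja : forall k n, k <= n -> j n <= j k.
  apply: int_step_antitone => i; rewrite /j (flux_step d c) //.
  rewrite mulrBr lerBlDr lerDl mulrA mulr_ge0 -?expr2 ?sqr_ge0 //.
  by rewrite addr_ge0 ?sqr_ge0.
apply/ler_addgt0Pl => eta eta0.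
have c0 : 0 < 1 + `|c| by rewrite ltr_wpDr.
have [m hm] := dec (eta / (1 + `|c|)) (divr_gt0 eta0 c0).
pose i := if n <= m + 1 then m + 1 else n.
have [mi ni] : m <= i - 1 /\ n <= i by rewrite /i; case: (leP n (m + 1)) => ?;
  lia.
have h1 : `|c * flux u v i| <= eta.
  have := hm _ mi; rewrite subrK => /(le_trans (flux_le u v i)) h.
  rewrite normrM (le_trans (ler_wpM2l _ h)) // mulrA ler_pdivrMr //.
  rewrite mulrC ler_pM2l //; lra.
have := ja _ _ ni; rewrite /j; move: h1; rewrite ler_norml; lra.
Qed.

(** Let [X + i X'] and [Y + i Y'] be the products [conj u * v] and [conj u' * v'], whose imaginary
    parts are the fluxes. If the Wronskian vanishes, the first times the conjugate of the second is
    [|u v'|^2]. So [X Y + X' Y' >= 0] and [X' Y = X Y'], which excludes [X' Y' < 0]. *)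
Lemma wronskian_neq0 u v u' v' n : flux u v n * flux u' v' n < 0 ->
  wronskian u v u' v' n != 0.
Proof.
rewrite /flux /wronskian => h; apply/eqP => w0.
move: h w0.
case: (u (n - 1)) (v n) (u' (n - 1)) (v' n) => [a a'] [b b'] [x x'] [y y'].
move=> /= h [/= h1 h2].
pose X := a * b + a' * b'; pose X' := a * b' - a' * b.
pose Y := x * y + x' * y'; pose Y' := x * y' - x' * y.
have hX' : a * b' + - a' * b = X' by rewrite /X'; ring.
have hY' : x * y' + - x' * y = Y' by rewrite /Y'; ring.
rewrite hX' hY' in h.
have e1 : a * y - a' * y' = x * b - x' * b' by lra.
have e2 : a * y' + a' * y = x * b' + x' * b by lra.
have r : X * Y + X' * Y' = (a * y - a' * y') ^+ 2 + (a * y' + a' * y) ^+ 2.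
  transitivity ((a * y - a' * y') * (x * b - x' * b') +
    (a * y' + a' * y) * (x * b' + x' * b)).
    by rewrite /X /X' /Y /Y'; ring.
  by rewrite -e1 -e2 !expr2.
have s : X' * Y = X * Y'.
  apply/eqP; rewrite -subr_eq0; apply/eqP.
  transitivity ((a * y - a' * y') * (x * b' + x' * b) -
    (a * y' + a' * y) * (x * b - x' * b')).
    by rewrite /X /X' /Y /Y'; ring.
  by rewrite -e1 -e2; ring.
have t : 0 <= (X * Y) * (X' * Y').
  have -> : X * Y * (X' * Y') = (X' * Y) * (X * Y') by ring.
  by rewrite s -expr2 sqr_ge0.
have XY : X * Y <= 0.
  by rewrite leNgt; apply/negP => XY; move: t;
    rewrite (pmulr_rge0 _ XY) leNgt h.
have : 0 <= X * Y + X' * Y' by rewrite r addr_ge0 ?sqr_ge0.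
lra.
Qed.

Section admissible.
Context {d : dirac_data R} {L : R} {kap : int -> R} (A : admissible d L kap).
Context {K : R} (kapK : sum_bounded kap K).

Lemma left_sol : sol d (left_u d) (left_v d).
Proof.
move=> n; have t0 := th_neq0 _ _ _ A; have p0 := pc_neq0 _ _ _ A n.
rewrite /left_u /left_v subrK (jost_step A kapK) /step /=.
rewrite opprD expfzDr // -[th d ^ (- 1)]/((th d)^-1).
move: (th d ^ (- n)) (jost d n) => t x.
by split; field; rewrite ?t0 ?p0.
Qed.

(** The second factor bounds the rescaled solution in [jost_norm]. The summand [l^2] serves
    [left_u], which pays an extra [th^-1], and [1 + l^2] serves [left_v]. *)
Definition jost_const (l k : R) : R :=
  (l ^+ 2 + (1 + l ^+ 2)) * (expR (2 * (1 + l) * (1 + l + l ^+ 2) * k)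
    * (2 * l)).

Lemma left_bound n :
  normc (left_u d n) <= jost_const L K * normc (th d) ^ (- n) /\
  normc (left_v d n) <= jost_const L K * normc (th d) ^ (- n).
Proof.
have L0 := slope_bound_ge0 A; have t0 := normc_gt0 _ (th_neq0 _ _ _ A).
have tn := exprz_ge0 (- n) (ltW t0).
have E0 : 0 <= expR (2 * (1 + L) * (1 + L + L ^+ 2) * K) * (2 * L).
  by rewrite mulr_ge0 ?expR_ge0 ?mulr_ge0.
have jb k := jost_bound A kapK k.
have L2 : 0 <= L ^+ 2 by exact: sqr_ge0.
rewrite /jost_const; move: jb E0.
move: (expR _ * _) => B jb B0; split.
  rewrite /left_u normcM normcXz opprD expfzDr ?gt_eqF //.
  rewrite -[normc (th d) ^ (- 1)]/((normc (th d))^-1)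
    -[leLHS]mulrA [leRHS]mulrC.
  rewrite ler_wpM2l // mulrDl -[leLHS]addr0 lerD ?mulr_ge0 ?addr_ge0 //.
  rewrite expr2 -mulrA -normcV ler_pM ?normc_ge0 ?(thV_le _ _ _ A) //.
  by rewrite (le_trans (fst_le A _)) // ler_wpM2l.
rewrite /left_v normcM normcXz [leRHS]mulrC ler_wpM2l // mulrDl -[leLHS]add0r.
rewrite lerD ?mulr_ge0 // (le_trans (snd_le A _)) // ler_wpM2l ?addr_ge0 //.
Qed.

Lemma jost_const_ge0 : 0 <= jost_const L K.
Proof.
have L0 := slope_bound_ge0 A.
by rewrite mulr_ge0 ?addr_ge0 ?sqr_ge0 ?mulr_ge0 ?expR_ge0.
Qed.

Lemma left_neq0 n : exists2 k, k < n & left_u d k != 0.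
Proof.
have L1 := L_ge1 _ _ _ A; have L0 : 0 < L by lra.
(* Within [(2 * L)^-1] of [(1, slope_minus)] the first component differs from 1 by at most 1/2, so
   it cannot vanish. *)
have [m hm] := jost_asymp A kapK (2 * L)^-1 ltac:(rewrite invr_gt0 mulr_gt0 //).
pose k := if n <= m then n - 1 else m - 1.
have [km kn] : k + 1 <= m /\ k < n by rewrite /k; case: (leP n m) => ?; lia.
exists k => //; rewrite mulf_neq0 // ?expfz_neq0 ?(th_neq0 _ _ _ A) //.
have := le_trans (fst_le A _) (ler_wpM2l (ltW L0) (hm _ km)); rewrite /=.
apply: contraTneq => ->; rewrite sub0r normcN normc1 -ltNge.
rewrite invfM mulrCA mulfV ?gt_eqF // mulr1; lra.
Qed.

Lemma left_decay : normc (th d) < 1 -> forall eta, 0 < eta ->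
  exists m : int, forall n, n <= m ->
    normc (left_u d (n - 1)) * normc (left_v d n) <= eta.
Proof.
move=> t1 eta eta0; set t := normc (th d) in t1.
have t0 : 0 < t := normc_gt0 _ (th_neq0 _ _ _ A).
have B0 := jost_const_ge0; set B := jost_const L K in B0.
have B20 : 0 <= B * B by rewrite mulr_ge0.
have e1 : 0 < eta / (1 + B * B) by rewrite divr_gt0 // ltr_wpDr.
have tc : t ^+ n @[n --> \oo] --> (0 : R) by apply: cvg_expr; rewrite gtr0_norm.
have /cvgrPdist_lt/(_ _ e1)[N _ hN] := tc.
exists (- N%:Z) => n nN.
have [b1 _] := left_bound (n - 1); have [_ b2] := left_bound n.
rewrite (le_trans (ler_pM _ _ b1 b2)) ?normc_ge0 // -/t -/B mulrACA.
rewrite -expfzDr ?gt_eqF //.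
have [k kN ->] : exists2 k : nat, (N <= k)%N & - (n - 1) - n = k%:Z.
  by exists `|- (n - 1) - n|%N; lia.
have := hN k kN; rewrite /= sub0r normrN gtr0_norm ?exprn_gt0 // => h.
rewrite (le_trans (ler_wpM2l B20 (ltW h))) // mulrA ler_pdivrMr ?ltr_wpDr //.
rewrite mulrC ler_pM2l //; lra.
Qed.

Lemma left_flux_nonreal c : selfadj d c -> c != 0 -> normc (th d) < 1 ->
  forall n, c * flux (left_u d) (left_v d) n < 0.
Proof.
move=> sa c0 t1 n; have [k kn k0] := left_neq0 n.
have := flux_left d c _ _ sa left_sol (left_decay t1) k n kn.
move=> /le_lt_trans -> //; rewrite oppr_lt0 mulr_gt0 ?exprn_even_gt0 //.
by rewrite ltr_pwDl ?sqr_ge0 // exprn_gt0 // normc_gt0.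
Qed.

(** The flux is constant and the factors [th^(-n)] have modulus 1, so its value is its limit at -oo,
    the flux of the free eigenvector [(1, slope_minus)]. *)
Lemma left_flux_real : selfadj d 0 -> normc (th d) = 1 ->
  forall n, flux (left_u d) (left_v d) n = cIm (slope_minus d).
Proof.
move=> sa t1 n.
have fc k : flux (left_u d) (left_v d) k = flux (left_u d) (left_v d) 0.
  by apply: int_step_const => {}k; rewrite (flux_step d 0) ?mul0r ?subr0 //;
    exact: left_sol.
have fE k : flux (left_u d) (left_v d)
  k = cIm (conjc (jost d k).1 * (jost d k).2).
  rewrite /flux /left_u /left_v subrK rmorphM /= mulrACA.
  have -> : (conjc (th d ^ (- k)) * th d ^ (- k)) = 1.
    have : normc (th d ^ (- k)) = 1 by rewrite normcXz t1 exp1rz.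
    case: (th d ^ (- k)) => x y /(congr1 (fun z => z ^+ 2)).
    rewrite normc_sqr expr1n /= => h; apply: complexP => /=; last by ring.
    by rewrite -h; ring.
  by rewrite mul1r.
rewrite fc; have L0 := slope_bound_ge0 A.
have lim (p : R[i] * R[i] -> R[i]) B : 0 <= B -> (forall x y,
  p (x - y) = p x - p y) ->
    (forall x, normc (p x) <= B * jost_norm d x) ->
    ccvg \oo (fun N : nat => p (jost d (- N%:Z))) (p (1, slope_minus d)).
  move=> B0 pD pB; apply: dist_ccvg; apply/cvgrPdist_le => eta eta0.
  have [m hm] := jost_asymp A kapK (eta / (1 + B))
    ltac:(rewrite divr_gt0 // ltr_wpDr //).
  exists `|m|%N => // N /= mN; rewrite sub0r normrN ger0_norm ?normc_ge0 // -pD.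
  have Nm : - N%:Z <= m by lia.
  apply: le_trans (pB _) _; apply: le_trans (ler_wpM2l B0 (hm _ Nm)) _.
  by rewrite mulrA ler_pdivrMr ?ltr_wpDr // mulrC ler_pM2l //; lra.
have l1 := lim fst L L0 (fun _ _ => erefl) (fst_le A).
have l2 := lim snd _ (addr_ge0 ler01 (sqr_ge0 L)) (fun _ _ => erefl) (snd_le A).
have [_ /=] := ccvgM _ _ _ _ (ccvg_conj _ _ l1) l2.
rewrite (_ : conjc 1 * _ = slope_minus d); last by rewrite rmorph1 mul1r.
have -> : (fun N : nat => cIm (conjc (jost d (- N%:Z)).1 * (jost d (- N%:Z)).2))
  =
    (fun=> flux (left_u d) (left_v d) 0) by apply/funext => N; rewrite -fE fc.
by move=> h; apply: (cvg_unique _ (cvg_cst _) h).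
Qed.

End admissible.

(** The reflection swaps the two components of the state, which conjugates their product and so
    reverses its imaginary part. *)
Lemma flux_mirror d n :
  flux (right_u d) (right_v d) n = - flux (left_u (mirror d))
    (left_v (mirror d)) (1 - n).
Proof.
rewrite /flux /right_u /right_v (_ : - (n - 1) = 1 - n); last by lia.
rewrite (_ : 1 - n - 1 = - n); last by lia.
case: (left_u _ _) (left_v _ _) => [x x'] [y y'] /=; ring.
Qed.

End Solutions.

(** * Continuity in a parameter *)

Section Family.
Context {R : realType}.
Implicit Types (d : dirac_data R) (n : int) (q : int -> R).

Record nondegen d : Prop := Nondegen {
  nd_al0 : al0 d != 0; nd_be0 : be0 d != 0; nd_th : th d != 0;
  nd_th_le1 : normc (th d) <= 1;
  nd_trace : th d + (th d)^-1 = 2 - al0 d * be0 d;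
  nd_thV : (th d)^-1 != th d }.

(** [q] dominates [pc^-1 - 1] separately, because a bound on [pc - 1] alone would let [pc] come
    arbitrarily close to 0. *)
Record perturbation d q : Prop := Perturbation {
  pt_pc : forall n, pc d n != 0;
  pt_al : forall n, normc (al d n - al0 d) <= q n;
  pt_be : forall n, normc (be d n - be0 d) <= q n;
  pt_pc1 : forall n, normc (pc d n - 1) <= q n;
  pt_pcV : forall n, normc ((pc d n)^-1 - 1) <= q n }.

Lemma nondegen_mirror d : nondegen d -> nondegen (mirror d).
Proof. by case=> *; split => //=; rewrite mulrC. Qed.

Lemma perturbation_mirror d q : perturbation d q ->
  perturbation (mirror d) (fun n => q (- n)).
Proof. by case=> *; split => /=. Qed.

Lemma slope_gapE d : nondegen d ->
  slope_minus d - slope_plus d = (th d - (th d)^-1) / be0 d.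
Proof.
by case=> _ b0 t0 _ _ _; rewrite /slope_minus /slope_plus; field; rewrite b0 t0.
Qed.

Lemma slope_gap_neq0 d : nondegen d -> slope_minus d - slope_plus d != 0.
Proof.
move=> nd; rewrite slope_gapE // mulf_neq0 ?invr_neq0 ?(nd_be0 _ nd) //.
by rewrite subr_eq0 eq_sym (nd_thV _ nd).
Qed.

(** [|pc^-1| <= 2 M] gives [3 M q] for [entry12] and [entry21]. For [entry22] the three terms of the
    decomposition cost [q], [4 M^2 q] and [3 M^2 q], which stays below [(1 + 12 M^2) q]. *)
Lemma admissible_intro d q M L : nondegen d -> perturbation d q ->
  1 <= M -> (forall n, q n <= M) -> normc (al0 d) <= M -> normc (be0 d) <= M ->
  1 <= L -> normc (slope_plus d) <= L -> normc (slope_minus d) <= L ->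
  normc (slope_minus d - slope_plus d)^-1 <= L -> normc (th d)^-1 <= L ->
  admissible d L (fun n => (1 + 12 * M ^+ 2) * q n).
Proof.
move=> nd pt M1 qM aM bM L1 spL smL gL tL.
have q0 n : 0 <= q n := le_trans (normc_ge0 _) (pt_pc1 _ _ pt n).
have rM n : normc (pc d n)^-1 <= 2 * M.
  rewrite -[_^-1](subrK 1) (le_trans (normcD _ _)) // normc1.
  by have := pt_pcV _ _ pt n; have := qM n; lra.
have mul (a b : R[i]) (x y : R) : normc a <= x -> normc b <= y ->
  normc (a * b) <= x * y.
  by move=> ? ?; rewrite normcM ler_pM ?normc_ge0.
have e2 x x0 n : normc x0 <= M -> normc (x - x0) <= q n ->
    normc (x / pc d n - x0) <= 3 * M * q n.
  move=> x0M xx; rewrite (_ : _ - x0 = (x - x0)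
    / pc d n + x0 * ((pc d n)^-1 - 1)).
    rewrite (le_trans (normcD _ _)) //.
    have := mul _ _ _ _ xx (rM n).
    by have := mul _ _ _ _ x0M (pt_pcV _ _ pt n); lra.
  by ring.
have MM : 3 * M <= 1 + 12 * M ^+ 2 by nra.
have M21 : 1 <= 1 + 12 * M ^+ 2 by rewrite lerDl mulr_ge0 ?sqr_ge0.
have kM c n : c <= 1 + 12 * M ^+ 2 -> c * q n <= (1 + 12 * M ^+ 2) * q n.
  by move=> h; rewrite ler_wpM2r.
split => //; [exact: nd_be0 | exact: nd_th | exact: pt_pc pt | exact: nd_th_le1
  |
  exact: nd_trace | exact: slope_gap_neq0 | by rewrite -normcV | ..] => n.
- by rewrite (le_trans (pt_pcV _ _ pt n)) // -[leLHS]mul1r kM.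
- by rewrite (le_trans (e2 _ _ n bM (pt_be _ _ pt n))) // kM.
- by rewrite (le_trans (e2 _ _ n aM (pt_al _ _ pt n))) // kM.
rewrite (_ : _ - _ = (pc d n - 1) - (al d n / pc d n) * (be d n - be0 d) -
  be0 d * (al d n / pc d n - al0 d)); last by field; exact: pt_pc pt n.
have h3 := mul _ _ _ _ bM (e2 _ _ n aM (pt_al _ _ pt n)).
have aM2 : normc (al d n) <= 2 * M.
  rewrite -[al d n](subrK (al0 d)) (le_trans (normcD _ _)) //.
  by have := pt_al _ _ pt n; have := qM n; lra.
have h2 := mul _ _ _ _ (mul _ _ _ _ aM2 (rM n)) (pt_be _ _ pt n).
rewrite (le_trans (normcB _ _)) // (le_trans (lerD (normcB _ _) h3)) //.
have := pt_pc1 _ _ pt n; have qq := q0 n.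
have M0 : 0 <= M ^+ 2 * q n by rewrite mulr_ge0 ?sqr_ge0.
by move: h2; rewrite !mulrDl !expr2 in M0 *; lra.
Qed.

Context {T : Type} (F : set_system T) {FF : ProperFilter F}.

Record data_cvg (D : T -> dirac_data R) (D0 : dirac_data R) : Prop := DataCvg {
  al_cvg : forall n, ccvg F (fun t => al (D t) n) (al D0 n);
  be_cvg : forall n, ccvg F (fun t => be (D t) n) (be D0 n);
  pc_cvg : forall n, ccvg F (fun t => pc (D t) n) (pc D0 n);
  al0_cvg : ccvg F (fun t => al0 (D t)) (al0 D0);
  be0_cvg : ccvg F (fun t => be0 (D t)) (be0 D0);
  th_cvg : ccvg F (fun t => th (D t)) (th D0) }.

Lemma data_cvg_mirror D D0 : data_cvg D D0 ->
  data_cvg (fun t => mirror (D t)) (mirror D0).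
Proof. by case=> *; split => /=. Qed.

Lemma data_cvg_cst d : data_cvg (fun=> d) d.
Proof. by split=> *; exact: ccvg_cst. Qed.

Lemma ccvg_bounded (f : T -> R[i]) a : ccvg F f a ->
  \forall t \near F, normc (f t) <= normc a + 1.
Proof.
move=> /ccvg_normc fa; near=> t; apply: ltW; near: t.
by apply: (cvgr_lt _ fa); rewrite ltrDl.
Unshelve. all: by end_near. Qed.

Lemma ccvgXz (f : T -> R[i]) a (k : int) : a != 0 -> ccvg F f a ->
  ccvg F (fun t => f t ^ k) (a ^ k).
Proof.
move=> a0 fa; have X j : ccvg F (fun t => f t ^+ j) (a ^+ j).
  elim: j => [|j IH]; first exact: ccvg_cst.
  rewrite exprS; apply: ccvg_ext (fun t => esym (exprS _ _)) _; exact: ccvgM.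
case: k => j; first exact: X.
by apply: ccvgV; rewrite ?expf_neq0.
Qed.

Lemma slope_plus_cvg D D0 : be0 D0 != 0 -> data_cvg D D0 ->
  ccvg F (fun t => slope_plus (D t)) (slope_plus D0).
Proof.
move=> b0 c; apply: ccvgM; last by apply: ccvgV b0 (be0_cvg _ _ c).
by apply: ccvgB; [exact: ccvg_cst | exact: th_cvg].
Qed.

Lemma slope_minus_cvg D D0 : th D0 != 0 -> be0 D0 != 0 -> data_cvg D D0 ->
  ccvg F (fun t => slope_minus (D t)) (slope_minus D0).
Proof.
move=> t0 b0 c; apply: ccvgM; last by apply: ccvgV b0 (be0_cvg _ _ c).
by apply: ccvgB; [exact: ccvg_cst | apply: ccvgV t0 (th_cvg _ _ c)].
Qed.

Section uniform.
Context {D : T -> dirac_data R} {D0 : dirac_data R} {q : int -> R} {K : R}.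
Hypotheses (DD0 : data_cvg D D0) (nd0 : nondegen D0) (pt0 : perturbation D0 q).
Hypothesis (ndpt : \forall t \near F, nondegen (D t) /\ perturbation (D t) q).
Hypothesis (qK : sum_bounded q K).

(** Each quantity at the limit, enlarged by 1, bounds the nearby ones as well; [M] contains [K] in
    order to dominate every [q n]. *)
Lemma uniformly_admissible : exists L kap K',
  [/\ sum_bounded kap K', admissible D0 L kap & \forall t \near F,
    admissible (D t) L kap].
Proof.
have b0 := nd_be0 _ nd0; have t0 := nd_th _ nd0;
  have g0 := slope_gap_neq0 _ nd0.
have c1 := slope_plus_cvg _ _ b0 DD0; have c2 := slope_minus_cvg _ _ t0 b0 DD0.
pose proof (ccvgV _ _ g0 (ccvgB _ _ _ _ c2 c1)) as c3.
pose proof (ccvgV _ _ t0 (th_cvg _ _ DD0)) as c4.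
pose b x : R := normc x + 1.
have b1 x : 1 <= b x by rewrite lerDr normc_ge0.
pose L := b (slope_plus D0) + b (slope_minus D0) +
  b (slope_minus D0 - slope_plus D0)^-1 + b (th D0)^-1.
have K0 := sum_bounded_ge0 _ _ qK.
pose M := b (al0 D0) + b (be0 D0) + K.
have L1 : [/\ b (slope_plus D0) <= L, b (slope_minus D0) <= L,
    b (slope_minus D0 - slope_plus D0)^-1 <= L, b (th D0)^-1 <= L & 1 <= L].
  have := (b1 (slope_plus D0), b1 (slope_minus D0),
    b1 (slope_minus D0 - slope_plus D0)^-1, b1 (th D0)^-1).
  by rewrite /L => -[[[]]] *; split; lra.
have M1 : [/\ b (al0 D0) <= M, b (be0 D0) <= M, K <= M & 1 <= M].
  by have := (b1 (al0 D0), b1 (be0 D0)); rewrite /M => -[] *; split; lra.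
have [l1 l2 l3 l4 l5] := L1; have [m1 m2 m3 m4] := M1.
have bb x y : b x <= y -> normc x <= y by apply: le_trans; rewrite lerDl.
have qM n : q n <= M := le_trans (sum_bounded_single _ _ n qK) m3.
exists L, (fun n => (1 + 12 * M ^+ 2) * q n), ((1 + 12 * M ^+ 2) * K); split.
- by apply: sum_boundedZ => //; have := sqr_ge0 M; lra.
- by apply: admissible_intro => //; exact: bb.
pose proof (ccvg_bounded _ _ c1) as n1; pose proof (ccvg_bounded _ _ c2) as n2.
pose proof (ccvg_bounded _ _ c3) as n3; pose proof (ccvg_bounded _ _ c4) as n4.
pose proof (ccvg_bounded _ _ (al0_cvg _ _ DD0)) as n5.
pose proof (ccvg_bounded _ _ (be0_cvg _ _ DD0)) as n6.
near=> t; have [nd pt] : nondegen (D t) /\ perturbation (D t) q by near: t.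
apply: admissible_intro => //.
- by apply: le_trans m1; near: t.
- by apply: le_trans m2; near: t.
- by apply: le_trans l1; near: t.
- by apply: le_trans l2; near: t.
- by apply: le_trans l3; near: t.
- by apply: le_trans l4; near: t.
Unshelve. all: by end_near. Qed.

End uniform.

Section continuity.
Context {D : T -> dirac_data R} {D0 : dirac_data R} {kap : int -> R} {L K : R}.
Hypotheses (DD0 : data_cvg D D0) (A0 : admissible D0 L kap).
Hypothesis (A : \forall t \near F, admissible (D t) L kap).
Hypothesis (kapK : sum_bounded kap K).

Lemma steps_ccvg n N :
  ccvg F (fun t => (steps (D t) n N (1, slope_minus (D t))).1)
    (steps D0 n N (1, slope_minus D0)).1 /\
  ccvg F (fun t => (steps (D t) n N (1, slope_minus (D t))).2)
    (steps D0 n N (1, slope_minus D0)).2.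
Proof.
elim: N n => [|N IH] n /=.
  split; first exact: ccvg_cst.
  by apply: slope_minus_cvg => //; [exact: th_neq0 A0 | exact: be0_neq0 A0].
have [c1 c2] := IH (n - 1); have ct := th_cvg _ _ DD0.
have ca := al_cvg _ _ DD0 (n - 1); have cb := be_cvg _ _ DD0 (n - 1).
have cp := pc_cvg _ _ DD0 (n - 1).
pose proof (ccvgM _ _ _ _ (ccvgB _ _ _ _ c1 (ccvgM _ _ _ _ cb c2))
  (ccvgV _ _ (pc_neq0 _ _ _ A0 (n - 1)) cp)) as cu.
split; first exact: ccvgM.
by apply: ccvgM => //; apply: ccvgD; exact: ccvgM.
Qed.

(** The truncation error of the infinite product is uniform in [t], and a truncated product depends
    continuously on finitely many coefficients. *)
Lemma jost_ccvg n :
  ccvg F (fun t => (jost (D t) n).1) (jost D0 n).1 /\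
  ccvg F (fun t => (jost (D t) n).2) (jost D0 n).2.
Proof.
have k (p : R[i] * R[i] -> R[i]) B : 0 <= B -> (forall x y,
  p (x - y) = p x - p y) ->
    (forall d x, admissible d L kap -> normc (p x) <= B * jost_norm d x) ->
    (forall N, ccvg F (fun t => p (steps (D t) n N (1, slope_minus (D t))))
      (p (steps D0 n N (1, slope_minus D0)))) ->
    ccvg F (fun t => p (jost (D t) n)) (p (jost D0 n)).
  move=> B0 pB pn ps; apply: dist_ccvg; apply/cvgrPdist_le => eta eta0.
  (* Two truncation errors [B * eta'], one for the limit and one for [D t], and an error [eta']
     between the truncated products add up to [eta]. *)
  pose eta' := eta / (2 * B + 1).
  have B1 : 0 < 2 * B + 1 by rewrite ltr_wpDl ?mulr_ge0.
  have e1 : 0 < eta' by rewrite divr_gt0.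
  have [N hN] := steps_fine A0 kapK n _ e1.
  pose proof (ccvg_dist _ _ (ps N)) as h; move/cvgrPdist_le/(_ _ e1) : h => h.
  near=> t; rewrite sub0r normrN ger0_norm ?normc_ge0 //.
  have At : admissible (D t) L kap by near: t.
  have j0 := le_trans (pn _ _ A0) (ler_wpM2l B0 (jost_approx A0 kapK _ _ _ hN)).
  have jt := le_trans (pn _ _ At) (ler_wpM2l B0 (jost_approx At kapK _ _ _ hN)).
  have st : normc (p (steps (D t) n N (1, slope_minus (D t))) -
      p (steps D0 n N (1, slope_minus D0))) <= eta'.
    have : `|0 - normc (p (steps (D t) n N (1, slope_minus (D t))) -
      p (steps D0 n N (1, slope_minus D0)))| <= eta' by near: t.
    by rewrite sub0r normrN ger0_norm ?normc_ge0.
  move: j0 jt st; rewrite !pB.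
  move: (p (jost D0 n)) (p (jost (D t) n)) (p (steps D0 _ _ _)) (p (steps (D t)
    _ _ _)).
  move=> a b x y j0 jt st.
  rewrite (_ : b - a = (b - y) + (y - x) - (a - x)); last by ring.
  rewrite (le_trans (normcB _ _)) // (le_trans (lerD (normcD _ _) (lexx _))) //.
  have -> : eta = (2 * B + 1) * eta' by rewrite /eta' mulrC divfK ?gt_eqF.
  lra.
have L0 := slope_bound_ge0 A0.
split; [apply: (k fst L) | apply: (k snd (1 + L ^+ 2))] => //.
- by move=> d x /fst_le.
- by move=> N; have [] := steps_ccvg n N.
- by rewrite addr_ge0 ?sqr_ge0.
- by move=> d x /snd_le.
- by move=> N; have [] := steps_ccvg n N.
Unshelve. all: by end_near. Qed.

Lemma left_ccvg n :
  ccvg F (fun t => left_u (D t) n) (left_u D0 n)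
    /\ ccvg F (fun t => left_v (D t) n) (left_v D0 n).
Proof.
have [c1 _] := jost_ccvg (n + 1); have [_ c2] := jost_ccvg n.
have t0 := th_neq0 _ _ _ A0.
by split; apply: ccvgM => //; apply: ccvgXz => //; exact: th_cvg DD0.
Qed.

End continuity.
End Family.

(** * The Green operator *)

Section Green.
Context {R : realType}.
Implicit Types (d : dirac_data R) (w : spinor R) (n k : int) (s t M : R).

Lemma upperE (a : R[i]) (w1 w2 : spinor R) n :
  upper (a *: w1 + w2) n = a * upper w1 n + upper w2 n.
Proof. by rewrite /upper !mxE. Qed.

Lemma lowerE (a : R[i]) (w1 w2 : spinor R) n :
  lower (a *: w1 + w2) n = a * lower w1 n + lower w2 n.
Proof. by rewrite /lower !mxE. Qed.

Lemma upperB (w1 w2 : spinor R) n : upper (w1 - w2) n = upper w1 n - upper w2 n.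
Proof. by rewrite /upper !mxE. Qed.

Lemma lowerB (w1 w2 : spinor R) n : lower (w1 - w2) n = lower w1 n - lower w2 n.
Proof. by rewrite /lower !mxE. Qed.

Lemma upper0 n : upper (0 : spinor R) n = 0.
Proof. by rewrite /upper mxE. Qed.

Lemma lower0 n : lower (0 : spinor R) n = 0.
Proof. by rewrite /lower mxE. Qed.

Lemma spinorP (w1 w2 : spinor R) : (forall n, upper w1 n = upper w2 n) ->
  (forall n, lower w1 n = lower w2 n) -> w1 = w2.
Proof.
move=> hu hl; apply/funext => n; apply/matrixP => i j; rewrite (ord1 j).
have : (i == 0) || (i == 1) by case: i => [[|[|]]].
by case/orP => /eqP ->; [exact: hu | exact: hl].
Qed.

Definition mk_spinor (u v : int -> R[i]) : spinor R :=
  fun n => \col_i (if i == 0 then u n else v n).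

Lemma upper_mk u v n : upper (mk_spinor u v) n = u n.
Proof. by rewrite /upper mxE. Qed.

Lemma lower_mk u v n : lower (mk_spinor u v) n = v n.
Proof. by rewrite /lower mxE. Qed.

Definition abs_sum w k : R := normc (upper w k) + normc (lower w k).

Lemma abs_sum_ge0 w k : 0 <= abs_sum w k.
Proof. by rewrite addr_ge0 ?normc_ge0. Qed.

Lemma abs_sum_sqr w k : abs_sum w k ^+ 2 <= 2 * density w k.
Proof.
by rewrite /abs_sum /density; have :=
  sqr_ge0 (normc (upper w k) - normc (lower w k)); lra.
Qed.

Lemma l2_lin s (a : R[i]) (w1 w2 : spinor R) : l2 s w1 -> l2 s w2 ->
  l2 s (a *: w1 + w2).
Proof.
move=> /l2P[M1 h1] /l2P[M2 h2]; apply/l2P.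
exists (2 * normc a ^+ 2 * M1 + 2 * M2).
have a0 : 0 <= 2 * normc a ^+ 2 by rewrite mulr_ge0 ?sqr_ge0.
apply: sum_bounded_le (sum_boundedD _ _ _ _ (sum_boundedZ _ _ _ a0 h1)
  (sum_boundedZ _ _ _ (ler0n _ 2) h2)) => k.
rewrite mulrCA (mulrCA 2 (weight s k))
  -mulrDr ler_wpM2l ?(ltW (weight_gt0 _ _)) //.
rewrite /density upperE lowerE.
have h (x y : R[i]) : normc (a * x + y) ^+ 2 <=
    2 * normc a ^+ 2 * normc x ^+ 2 + 2 * normc y ^+ 2.
  apply: (@le_trans _ _ ((normc (a * x) + normc y) ^+ 2)).
    by rewrite ler_pXn2r ?nnegrE ?addr_ge0 ?normc_ge0 ?normcD.
  by rewrite normcM; have := sqr_ge0 (normc a * normc x - normc y); lra.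
by have := h (upper w1 k) (upper w2 k); have := h (lower w1 k) (lower w2 k);
  lra.
Qed.

Lemma l2_sub0 s w : 0 <= s -> l2 s w -> l2 0 w.
Proof.
move=> s0 /l2P[M h]; apply/l2P; exists M; apply: sum_bounded_le h => k.
by rewrite weight0 ler_wpM2r ?density_ge0 // weight_ge1.
Qed.

Lemma op_norm_le s t (A : spinor R -> spinor R) c : 0 <= c ->
  (forall w M, sum_bounded (fun k => weight s k * density w k) M ->
    sum_bounded (fun k => weight t k * density (A w) k) (c * M)) ->
  (op_norm s t A <= (Num.sqrt c)%:E)%E.
Proof.
move=> c0 h; apply: ge_ereal_sup => _ [w /= w1 <-].
apply/l2_normP; first exact: sqrtr_ge0.
rewrite sqr_sqrtr // -[c]mulr1 -[X in c * X](expr1n _ 2); apply: h.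
exact/(l2_normP _ _ _ ler01).
Qed.

Lemma bounded_opsI s t (A : spinor R -> spinor R) c : 0 <= c ->
  linear_on s A ->
  (forall w M, sum_bounded (fun k => weight s k * density w k) M ->
    sum_bounded (fun k => weight t k * density (A w) k) (c * M)) ->
  bounded_ops s t A.
Proof.
move=> c0 lA h; split => //.
  by move=> w /l2P[M /h hM]; apply/l2P; exists (c * M).
exact: le_lt_trans (op_norm_le _ _ _ _ c0 h) (ltry _).
Qed.

Definition dirac_mx d w : spinor R := mk_spinor
  (fun n => al d n * upper w n + pc d n * lower w n - lower w (n + 1))
  (fun n => pc d n * upper w n - upper w (n - 1) + be d n * lower w n).

Lemma dirac_mx_lin d a (w1 w2 : spinor R) :
  dirac_mx d (a *: w1 + w2) = a *: dirac_mx d w1 + dirac_mx d w2.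
Proof.
apply: spinorP => n; rewrite (upperE, lowerE) !(upper_mk, lower_mk) !(upperE,
  lowerE);
  ring.
Qed.

Lemma sol_dirac_mx d w : dirac_mx d w = 0 -> sol d (upper w) (lower w).
Proof.
move=> h n; split.
  by have := congr1 (fun x => lower x n) h; rewrite lower_mk lower0.
by have := congr1 (fun x => upper x n) h; rewrite upper_mk upper0.
Qed.

Lemma dirac_mx_l2 d B : (forall n, normc (al d n) <= B) ->
  (forall n, normc (be d n) <= B) -> (forall n, normc (pc d n) <= B) ->
  set_fun (l2 0) (l2 0) (dirac_mx d).
Proof.
move=> aB bB pB w /l2P[M wM]; apply/l2P.
have B0 : 0 <= B := le_trans (normc_ge0 _) (aB 0).
have dM : sum_bounded (density w) M by apply: sum_bounded_le wM => k;
  rewrite weight0 mul1r.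
have dp : sum_bounded (fun k => density w (k + 1)) M.
  by apply: (sum_bounded_inj _ _ (fun k => k + 1) _ dM) => x y; lia.
have dm : sum_bounded (fun k => density w (k - 1)) M.
  by apply: (sum_bounded_inj _ _ (fun k => k - 1) _ dM) => x y; lia.
have c0 : 0 <= 3 * B ^+ 2 * 2 by rewrite !mulr_ge0 ?sqr_ge0.
have := sum_boundedD _ _ _ _ (sum_boundedZ _ _ _ c0 dM)
  (sum_boundedD _ _ _ _ (sum_boundedZ _ _ _ (ler0n _ 3) dp)
    (sum_boundedZ _ _ _ (ler0n _ 3) dm)).
set M' := (X in sum_bounded _ X) => hM; exists M';
  apply: sum_bounded_le hM => k.
rewrite weight0 mul1r /density /dirac_mx upper_mk lower_mk.
have h (a b c x y : R[i]) : normc a <= B -> normc b <= B ->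
    normc (a * x + b * y - c) ^+ 2 <= 3 * B ^+ 2 * (normc x ^+ 2 + normc y ^+ 2)
      + 3 * normc c ^+ 2.
  move=> ha hb; apply: (@le_trans _ _ ((B * normc x + B * normc y + normc c)
    ^+ 2)).
    rewrite ler_pXn2r ?nnegrE ?addr_ge0 ?mulr_ge0 ?normc_ge0 //.
    rewrite (le_trans (normcB _ _)) // lerD2r (le_trans (normcD _ _))
      // !normcM.
    by rewrite lerD // ler_wpM2r ?normc_ge0.
  move: (normc x) (normc y) (normc c) => x' y' c'.
  have := sqr_ge0 (B * x' - B * y'); have := sqr_ge0 (B * x' - c').
  by have := sqr_ge0 (B * y' - c'); lra.
have h1 := h _ _ (lower w (k + 1)) (upper w k) (lower w k) (aB k) (pB k).
have h2 := h _ _ (upper w (k - 1)) (upper w k) (lower w k) (pB k) (bB k).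
rewrite (addrAC _ (- _)).
have := sqr_ge0 (normc (upper w (k + 1)));
  have := sqr_ge0 (normc (lower w (k - 1))).
by move: h1 h2; lra.
Qed.

(** For a square summable solution [c * flux] at [k + 1] is at most [- c^2 * density] at [k] when
    seen from -oo and nonnegative when seen from +oo, so the density vanishes at every site. *)
Lemma dirac_mx_inj d c w : selfadj d c -> c != 0 -> l2 0 w ->
  dirac_mx d w = 0 -> w = 0.
Proof.
move=> sa c0 /l2P[M wM] /sol_dirac_mx sw.
have tail eta : 0 < eta -> exists N : nat, forall k,
  k \notin window N -> density w k <= eta.
  have f0 k : 0 <= weight 0 k * density w k by rewrite mulr_ge0 ?density_ge0
    ?(ltW (weight_gt0 _ _)).
  move=> /(sum_bounded_tail _ _ f0 wM)[N hN]; exists N => k kN.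
  have := hN [:: k] isT; rewrite big_seq1 weight0 mul1r; apply => j.
  by rewrite inE => /eqP ->.
have uv eta n : density w (n - 1) <= eta -> density w n <= eta ->
    normc (upper w (n - 1)) * normc (lower w n) <= eta.
  rewrite /density; have := sqr_ge0 (normc (upper w (n - 1))
    - normc (lower w n)).
  have := sqr_ge0 (normc (upper w n));
    have := sqr_ge0 (normc (lower w (n - 1))).
  lra.
have fl := flux_left d c _ _ sa sw _; have fr := flux_right d c _ _ sa sw _.
have D0 k : density w k = 0.
  apply/eqP; rewrite eq_le density_ge0 andbT.
  have : c * flux (upper w) (lower w) (k + 1) <= - (c ^+ 2 * density w k).
    apply: fl; last by lia.
    move=> eta /tail[N hN]; exists (- N%:Z - 1) => n nN.
    by apply: uv; apply: hN; rewrite mem_window_int; lia.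
  have : 0 <= c * flux (upper w) (lower w) (k + 1).
    apply: fr => eta /tail[N hN]; exists (N%:Z + 1) => n nN.
    rewrite -{1}[n](addrK 1).
    by apply: uv; rewrite ?addrK; apply: hN; rewrite mem_window_int; lia.
  have c2 : 0 < c ^+ 2 by rewrite exprn_even_gt0.
  by move=> h1 h2; rewrite -(pmulr_rle0 _ c2); lra.
apply: spinorP => k; have := D0 k; rewrite /density => /eqP;
  rewrite paddr_eq0 ?sqr_ge0 // !expf_eq0 /= => /andP[/eqP h1 /eqP h2].
  by rewrite (eq0_normc h1) /upper mxE.
by rewrite (eq0_normc h2) /lower mxE.
Qed.

(** [zsum] has the default value 0 when no limit exists, so linearity and the Green identity are
    stated under [convergent_rows]. *)
Definition green d w : spinor R :=
  mk_spinor (fun n => zsum (kernel_upper d w n))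
    (fun n => zsum (kernel_lower d w n)).

Lemma densityB w1 w2 k (a1 a2 b1 b2 : R[i]) :
  upper w1 k = a1 -> upper w2 k = a2 -> lower w1 k = b1 -> lower w2 k = b2 ->
  density (w1 - w2) k = normc (a1 - a2) ^+ 2 + normc (b1 - b2) ^+ 2.
Proof. by rewrite /density upperB lowerB => -> -> -> ->. Qed.

Definition convergent_rows d w := forall n,
  zcvg (kernel_upper d w n) (zsum (kernel_upper d w n))
    /\ zcvg (kernel_lower d w n) (zsum (kernel_lower d w n)).

Lemma green_lin d a (w1 w2 : spinor R) : convergent_rows d w1 ->
  convergent_rows d w2 ->
  green d (a *: w1 + w2) = a *: green d w1 + green d w2.
Proof.
move=> r1 r2; apply: spinorP => n; have [u1 v1] := r1 n; have [u2 v2] := r2 n.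
  rewrite upperE !upper_mk; apply: zsum_eq.
  apply: ccvg_ext (zcvgD _ _ _ _ (zcvgZ _ _ a u1) u2) => N.
  by apply: eq_bigr => k _; rewrite /kernel_upper upperE lowerE; ring.
rewrite lowerE !lower_mk; apply: zsum_eq.
apply: ccvg_ext (zcvgD _ _ _ _ (zcvgZ _ _ a v1) v2) => N.
by apply: eq_bigr => k _; rewrite /kernel_lower upperE lowerE; ring.
Qed.

Lemma dirac_green d w : sol d (left_u d) (left_v d) ->
  sol d (right_u d) (right_v d) ->
  jost_wronskian d != 0 -> convergent_rows d w -> dirac_mx d (green d w) = w.
Proof.
move=> sl sr W0 rw; apply: spinorP => n.
  rewrite /dirac_mx /green upper_mk upper_mk !lower_mk.
  have [c1 c2] := rw n; have [_ c3] := rw (n + 1).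
  rewrite -[- zsum (kernel_lower d w (n + 1))]mulN1r.
  have h := zcvgD _ _ _ _ (zcvgD _ _ _ _ (zcvgZ _ _ (al d n) c1)
    (zcvgZ _ _ (pc d n) c2))
    (zcvgZ _ _ (- 1) c3).
  apply: (ccvg_unique _ _ _ h).
  have e k : al d n * kernel_upper d w n k + pc d n * kernel_lower d w n k + -1
    * kernel_lower d w (n + 1) k =
      if k == n then upper w n else 0.
    by rewrite -(green_eq1 d w n k sl sr W0); ring.
  under eq_fun do under eq_bigr do rewrite e.
  have := zcvg_delta (fun k => if k == n then upper w n else 0) n _.
  by rewrite eqxx; apply => k /negPf ->.
rewrite /dirac_mx /green lower_mk lower_mk !upper_mk.
have [c1 c2] := rw n; have [c3 _] := rw (n - 1).
have h := zcvgD _ _ _ _ (zcvgD _ _ _ _ (zcvgZ _ _ (pc d n) c1) (zcvgZ _ _ (- 1)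
  c3))
  (zcvgZ _ _ (be d n) c2).
rewrite -[- zsum (kernel_upper d w (n - 1))]mulN1r.
apply: (ccvg_unique _ _ _ h).
have e k : pc d n * kernel_upper d w n k + -1 * kernel_upper d w (n - 1)
  k + be d n * kernel_lower d w n k =
    if k == n then lower w n else 0.
  by rewrite -(green_eq2 d w n k sl sr W0); ring.
under eq_fun do under eq_bigr do rewrite e.
have := zcvg_delta (fun k => if k == n then lower w n else 0) n _.
by rewrite eqxx; apply => k /negPf ->.
Qed.

Definition kernel_bound d B := forall n k,
  [/\ normc (cuu d n k) <= B * normc (th d) ^+ `|n - k|%N,
      normc (cuv d n k) <= B * normc (th d) ^+ `|n - k|%N,
      normc (cvu d n k) <= B * normc (th d) ^+ `|n - k|%N
    & normc (cvv d n k) <= B * normc (th d) ^+ `|n - k|%N].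

Lemma expz_dist (t : R) n k : k <= n ->
  t ^+ `|n - k|%N = t ^ (n - k) /\ t ^+ `|k - n|%N = t ^ (- k + n).
Proof. by move=> kn; rewrite !exprnP; split; congr (_ ^ _); lia. Qed.

Lemma kernel_boundI d C : th d != 0 ->
  (forall n, normc (left_u d n) <= C * normc (th d) ^ (- n) /\
             normc (left_v d n) <= C * normc (th d) ^ (- n)) ->
  (forall n, normc (right_u d n) <= C * normc (th d) ^ n /\
             normc (right_v d n) <= C * normc (th d) ^ n) ->
  kernel_bound d (normc (jost_wronskian d)^-1 * (C * C)).
Proof.
move=> /normc_gt0 t0 hl hr n k; move: (normc (th d)) t0 hl hr => t t0 hl hr.
have mul (a b : R[i]) (i j : int) : normc a <= C * t ^ i ->
  normc b <= C * t ^ j ->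
    normc (a * b) <= C * C * t ^ (i + j).
  move=> ha hb; rewrite expfzDr ?gt_eqF // mulrACA normcM.
  by rewrite ler_pM ?normc_ge0.
have [l1 l2] := hl n; have [l3 l4] := hl k.
have [r1 r2] := hr n; have [r3 r4] := hr k.
have key (cnd : bool) (a b a' b' : R[i]) : (cnd -> k <= n) -> (~~ cnd ->
  n <= k) ->
    normc a <= C * t ^ n -> normc b <= C * t ^ (- k) ->
    normc a' <= C * t ^ (- n) -> normc b' <= C * t ^ k ->
    normc ((jost_wronskian d)^-1 * (if cnd then a * b else a' * b')) <=
    normc (jost_wronskian d)^-1 * (C * C) * t ^+ `|n - k|%N.
  move=> h1 h2 ? ? ? ?; rewrite normcM -mulrA ler_wpM2l ?normc_ge0 //.
  case: cnd h1 h2 => h1 h2.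
    by rewrite (expz_dist t n k (h1 isT)).1; exact: mul.
  by rewrite (expz_dist t k n (h2 isT)).2; exact: mul.
have le1 : k < n -> k <= n := @ltW _ _ k n.
have le2 : ~~ (k < n) -> n <= k by rewrite -leNgt.
have le3 : ~~ (k <= n) -> n <= k by rewrite -ltNge => /ltW.
split; [exact: key id le3 _ _ _ _ | exact: key id le3 _ _ _ _ |
  exact: key le1 le2 _ _ _ _ | exact: key le1 le2 _ _ _ _].
Qed.

Section bounds.
Context {d : dirac_data R} {B : R} (KB : kernel_bound d B) (t1 : normc (th d)
  <= 1).

Lemma kernel_upper_bound w n k : normc (kernel_upper d w n k)
  <= B * normc (th d) ^+ `|n - k|%N * abs_sum w k.
Proof.
have [h1 h2 _ _] := KB n k; rewrite (le_trans (normcD _ _)) //.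
rewrite (normcM (cuu _ _ _)) (normcM (cuv _ _ _)) mulrDr.
by rewrite lerD // ler_wpM2r ?normc_ge0.
Qed.

Lemma kernel_lower_bound w n k : normc (kernel_lower d w n k)
  <= B * normc (th d) ^+ `|n - k|%N * abs_sum w k.
Proof.
have [_ _ h1 h2] := KB n k; rewrite (le_trans (normcD _ _)) //.
rewrite (normcM (cvu _ _ _)) (normcM (cvv _ _ _)) mulrDr.
by rewrite lerD // ler_wpM2r ?normc_ge0.
Qed.

Lemma kernel_const_ge0 : 0 <= B.
Proof.
have [h _ _ _] := KB 0 0; have := le_trans (normc_ge0 _) h.
by rewrite subrr expr0 mulr1.
Qed.

Lemma thX_le1 n : normc (th d) ^+ `|n|%N <= 1.
Proof. by rewrite exprn_ile1 ?normc_ge0. Qed.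

(** The auxiliary weight [p] is 1 when [|th| < 1] makes the powers summable, and [weight (- s)] when
    only [|th| <= 1] is known. The inequality [a <= p + a^2 / p] separates the kernel from the
    source. *)
Lemma rows_intro (p : int -> R) w P M : (forall k, 0 < p k) ->
  (forall n k, normc (th d) ^+ `|n - k|%N <= 1) ->
  (forall n, sum_bounded (fun k => normc (th d) ^+ `|n - k|%N * p k) P) ->
  sum_bounded (fun k => abs_sum w k ^+ 2 / p k) M -> convergent_rows d w.
Proof.
move=> p0 tk hP hM n; have B0 := kernel_const_ge0.
have le k : B * normc (th d) ^+ `|n - k|%N * abs_sum w k <=
    B * (normc (th d) ^+ `|n - k|%N * p k + abs_sum w k ^+ 2 / p k).
  rewrite -mulrA ler_wpM2l //.
  have := tk n k; have : 0 <= normc (th d)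
    ^+ `|n - k|%N by rewrite exprn_ge0 ?normc_ge0.
  move: (_ ^+ `|_|%N) => x x0 x1.
  have y0 : 0 <= abs_sum w k ^+ 2 / p k by rewrite divr_ge0 ?sqr_ge0 ?ltW.
  have py : abs_sum w k <= p k + abs_sum w k ^+ 2 / p k.
    have : 0 <= (p k - abs_sum w k)
      ^+ 2 / p k by rewrite divr_ge0 ?sqr_ge0 ?ltW.
    rewrite (_ : (p k - abs_sum w k)
      ^+ 2 / p k = p k + abs_sum w k ^+ 2 / p k - 2 * abs_sum w k).
      by have := abs_sum_ge0 w k; lra.
    by field; rewrite gt_eqF.
  rewrite (le_trans (ler_wpM2l x0 py)) // mulrDr lerD2l.
  by rewrite ler_piMl.
have bnd := sum_boundedZ _ _ _ B0 (sum_boundedD _ _ _ _ (hP n) hM).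
split; apply: zsumP; apply: sum_bounded_le bnd => k.
  exact: le_trans (kernel_upper_bound w n k) (le k).
exact: le_trans (kernel_lower_bound w n k) (le k).
Qed.

Lemma rows_l2 w : normc (th d) < 1 -> l2 0 w -> convergent_rows d w.
Proof.
move=> t1' /l2P[M wM].
have t01 : 0 <= normc (th d) < 1 by rewrite normc_ge0.
apply: (rows_intro (fun=> 1) w _ (2 * M)) => // [n k|n|].
- exact: thX_le1.
- by apply: sum_bounded_le (sum_bounded_geo _ n t01) => k; rewrite mulr1.
apply: sum_bounded_le (sum_boundedZ _ _ _ (ler0n _ 2) wM) => k.
by rewrite divr1 weight0 mul1r abs_sum_sqr.
Qed.

Lemma rows_weighted s w : 2^-1 < s -> l2 s w -> convergent_rows d w.
Proof.
move=> s1 /l2P[M wM]; have [P hP] := weight_summable s s1.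
apply: (rows_intro (weight (- s)) w P (2 * M)) => [k|n k|n|].
- exact: weight_gt0.
- exact: thX_le1.
- by apply: sum_bounded_le hP => k;
  rewrite ler_piMl ?thX_le1 ?(ltW (weight_gt0 _ _)).
apply: sum_bounded_le (sum_boundedZ _ _ _ (ler0n _ 2) wM) => k.
by rewrite weightN invrK [leLHS]mulrC [leRHS]mulrCA ler_wpM2l ?abs_sum_sqr ?(ltW
  (weight_gt0 _ _)).
Qed.

Lemma green_bounded_l2 : normc (th d) < 1 -> exists2 c, 0 <= c &
  forall w M, sum_bounded (fun k => weight 0 k * density w k) M ->
    sum_bounded (fun k => weight 0 k * density (green d w) k) (c * M).
Proof.
move=> t1'; have t01 : 0 <= normc (th d) < 1 by rewrite normc_ge0.
have B0 := kernel_const_ge0.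
pose S := B * (2 / (1 - normc (th d))).
(* One term for each component; the factor 2 is the loss in [abs_sum_sqr]. *)
exists (S ^+ 2 * 2 + S ^+ 2 * 2); first by have := sqr_ge0 S; lra.
move=> w M wM; have rw := rows_l2 w t1' ((l2P _ _).2 (ex_intro _ _ wM)).
pose K n k := B * normc (th d) ^+ `|n - k|%N.
have K0 n k : 0 <= K n k by rewrite mulr_ge0 ?exprn_ge0 ?normc_ge0.
have K1 n : sum_bounded (K n) S by apply: sum_boundedZ => //;
  exact: sum_bounded_geo.
have K2 k : sum_bounded (K ^~ k) S.
  by apply: sum_bounded_le (K1 k) => n;
    rewrite /K (_ : `|n - k|%N = `|k - n|%N) //; lia.
have ph : sum_bounded (fun k => abs_sum w k ^+ 2) (2 * M).
  by apply: sum_bounded_le (sum_boundedZ _ _ _ (ler0n _ 2) wM) => k;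
    rewrite weight0 mul1r abs_sum_sqr.
have h1 := schur_bound _ _ _ _ _ _ K0 (kernel_upper_bound w)
  (fun n => (rw n).1) K1 K2 ph.
have h2 := schur_bound _ _ _ _ _ _ K0 (kernel_lower_bound w)
  (fun n => (rw n).2) K1 K2 ph.
have -> : (S ^+ 2 * 2 + S ^+ 2 * 2) * M = S ^+ 2 * (2 * M) + S ^+ 2 * (2 * M)
  by ring.
apply: sum_bounded_le (sum_boundedD _ _ _ _ h1 h2) => k.
by rewrite weight0 mul1r /density upper_mk lower_mk.
Qed.

Lemma green_bounded_weighted s : 2^-1 < s -> exists2 c, 0 <= c &
  forall w M, sum_bounded (fun k => weight s k * density w k) M ->
    sum_bounded (fun k => weight (- s) k * density (green d w) k) (c * M).
Proof.
move=> s1; have B0 := kernel_const_ge0; have [P hP] := weight_summable s s1.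
have P0 := sum_bounded_ge0 _ _ hP.
pose H := B ^+ 2 * (P * P).
have H0 : 0 <= H by rewrite !mulr_ge0.
exists (H * 2 + H * 2); first by rewrite addr_ge0 ?mulr_ge0.
move=> w M wM; have rw := rows_weighted s w s1 ((l2P _ _).2 (ex_intro _ _ wM)).
have ph : sum_bounded (fun k => abs_sum w k ^+ 2 / weight (- s) k) (2 * M).
  apply: sum_bounded_le (sum_boundedZ _ _ _ (ler0n _ 2) wM) => k.
  by rewrite weightN invrK [leLHS]mulrC [leRHS]mulrCA ler_wpM2l ?abs_sum_sqr
    ?(ltW (weight_gt0 _ _)).
have KH (r r' : seq int) : uniq r -> uniq r' ->
    \sum_(n <- r) \sum_(k <- r') weight (- s) n * (B ^+ 2 * weight (- s) k)
      <= H.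
  move=> ur ur'; rewrite (eq_bigr (fun n => weight (- s)
    n * (B ^+ 2 * \sum_(k <- r') weight (- s) k))).
    rewrite -mulr_suml mulrC /H -mulrA ler_wpM2l ?sqr_ge0 // ler_pM ?hP
      ?sumr_ge0 //.
      by move=> k _; exact: ltW (weight_gt0 _ _).
    by move=> k _; exact: ltW (weight_gt0 _ _).
  by move=> n _; rewrite !mulr_sumr.
(* The decay of the kernel is discarded, so that the estimate covers [|th| = 1]. *)
have le n k (x : R) : x <= B * normc (th d) ^+ `|n - k|%N * abs_sum w k ->
  x <= B * abs_sum w k.
  move=> h; apply: le_trans h _; rewrite ler_wpM2r ?abs_sum_ge0 //.
  by rewrite ler_piMr ?thX_le1.
have h1 := hs_bound _ _ (fun _ _ => B) _ _ _ _ (weight_gt0 (- s))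
  (fun n k => le n k _ (kernel_upper_bound w n k)) (fun n => (rw n).1) KH ph.
have h2 := hs_bound _ _ (fun _ _ => B) _ _ _ _ (weight_gt0 (- s))
  (fun n k => le n k _ (kernel_lower_bound w n k)) (fun n => (rw n).2) KH ph.
have -> : (H * 2 + H * 2) * M = H * (2 * M) + H * (2 * M) by ring.
apply: sum_bounded_le (sum_boundedD _ _ _ _ h1 h2) => k.
by rewrite -mulrDr /density upper_mk lower_mk.
Qed.

End bounds.

End Green.

(** * Resolvent and Floquet multiplier *)

Section Resolvent.
Context {R : realType}.
Implicit Types (d : dirac_data R) (w : spinor R) (n k : int) (m : R)
  (z t : R[i]).
Implicit Types (Q : int -> 'M[R]_2).

(** The root [t] is an argument of its own, since [z] determines it only up to inversion. *)
Definition dirac_at m Q z t : dirac_data R := DiracData R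
  (fun n => (m + Q n 0 0)%:C - z) (fun n => (Q n 1 1 - m)%:C - z)
  (fun n => (1 + Q n 1 0)%:C) (m%:C - z) (- m%:C - z) t.

Lemma dirac_opE m Q z t w : (forall n, Q n 0 1 = Q n 1 0) ->
  dirac_op m Q w - z *: w = dirac_mx (dirac_at m Q z t) w.
Proof.
move=> Qs; apply: spinorP => n.
  rewrite upper_mk /upper /lower !mxE /= /fwd_diff big_ord_recl big_ord1 !mxE.
  rewrite (_ : lift ord0 ord0 = 1); last by apply/val_inj.
  by rewrite Qs !(rmorphD, rmorph1) /upper /lower; ring.
rewrite lower_mk /upper /lower !mxE /= /bwd_diff big_ord_recl big_ord1 !mxE.
rewrite (_ : lift ord0 ord0 = 1); last by apply/val_inj.
by rewrite !(rmorphD, rmorph1, rmorphN) /upper /lower; ring.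
Qed.

Record green_ready d (B : R) : Prop := GreenReady {
  gr_left : sol d (left_u d) (left_v d);
    gr_right : sol d (right_u d) (right_v d);
  gr_wronskian : jost_wronskian d != 0; gr_bound : kernel_bound d B;
    gr_th : normc (th d) <= 1 }.

(** Injectivity from the flux and the Green operator as a right inverse make [D - z] a bijection of
    [l2 0], on which the partial inverse is then the Green operator. *)
Lemma resolvent_green m Q z t c B : (forall n, Q n 0 1 = Q n 1 0) ->
  green_ready (dirac_at m Q z t) B -> normc t < 1 ->
  selfadj (dirac_at m Q z t) c -> c != 0 ->
  (exists M, forall n, [/\ normc (al (dirac_at m Q z t) n) <= M,
     normc (be (dirac_at m Q z t) n) <= M & normc (pc (dirac_at m Q z t) n)
       <= M]) ->
  set_bij (l2 0) (l2 0) (fun w => dirac_op m Q w - z *: w) /\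
  (forall w, l2 0 w -> resolvent m Q z w = green (dirac_at m Q z t) w).
Proof.
move=> Qs [sl sr W0 KB t1] t1' sa c0 [M bM].
have fE : (fun w => dirac_op m Q w - z *: w) = dirac_mx (dirac_at m Q z t).
  by apply/funext => w; exact: dirac_opE.
have bij : set_bij (l2 0) (l2 0) (dirac_mx (dirac_at m Q z t)).
  split.
  - by apply: (dirac_mx_l2 _ M) => n; have [] := bM n.
  - move=> w1 w2; rewrite !inE => h1 h2 e; apply/eqP; rewrite -subr_eq0;
    apply/eqP.
    have e0 : w1 - w2 = -1 *: w2 + w1 by rewrite scaleN1r addrC.
    apply: (dirac_mx_inj _ _ _ sa c0); first by rewrite e0; exact: l2_lin.
    by rewrite e0 dirac_mx_lin e scaleN1r addNr.
  - move=> w hw; exists (green (dirac_at m Q z t) w).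
      have [c' c'0 h] := green_bounded_l2 KB t1 t1'.
      by move: hw => /l2P[M' /h hM']; apply/l2P; exists (c' * M').
    by apply: dirac_green => //; exact: rows_l2.
split; first by rewrite fE.
move=> w hw; have rw := rows_l2 KB t1 w t1' hw.
rewrite -{1}(dirac_green _ _ sl sr W0 rw) /resolvent fE.
have [_ inj _] := bij; apply: pinvKV; first by move=> *; exact: inj.
have [c' c'0 h] := green_bounded_l2 KB t1 t1'; rewrite inE.
by move: hw => /l2P[M' /h hM']; apply/l2P; exists (c' * M').
Qed.

Lemma linear_green s d B : green_ready d B -> 2^-1 < s -> linear_on s (green d).
Proof.
move=> [_ _ _ KB t1] s1 a w1 w2 h1 h2.
by apply: green_lin; apply: (rows_weighted KB t1 s).
Qed.

Lemma linear_green0 d B : green_ready d B -> normc (th d) < 1 ->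
  linear_on 0 (green d).
Proof.
move=> [_ _ _ KB t1] t1' a w1 w2 h1 h2.
by apply: green_lin; exact: rows_l2.
Qed.

Lemma bounded_green s d B : green_ready d B -> 2^-1 < s ->
  bounded_ops s (- s) (green d).
Proof.
move=> gr s1; have [_ _ _ KB t1] := gr.
have [c c0 h] := green_bounded_weighted KB t1 s s1.
exact: bounded_opsI c0 (linear_green _ _ _ gr s1) h.
Qed.

Lemma bounded_green0 d B : green_ready d B -> normc (th d) < 1 ->
  bounded_ops 0 0 (green d).
Proof.
move=> gr t1'; have [_ _ _ KB t1] := gr.
have [c c0 h] := green_bounded_l2 KB t1 t1'.
exact: bounded_opsI c0 (linear_green0 _ _ gr t1') h.
Qed.

Lemma bounded_ops_ext s (t : R) (A A' : spinor R -> spinor R) :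
  (forall w, l2 s w -> A w = A' w) -> bounded_ops s t A -> bounded_ops s t A'.
Proof.
move=> e [f l b].
have l1 w : (l2_norm s w <= 1)%E -> l2 s w by move=> h;
  exact: le_lt_trans h (ltry 1).
split.
- by move=> w hw; rewrite -e //; exact: f.
- by move=> a w1 w2 h1 h2; rewrite -!e ?l //; exact: l2_lin.
rewrite (_ : op_norm s t A' = op_norm s t A) //; congr ereal_sup.
by apply/seteqP; split => _ [w /= w1 <-]; exists w; rewrite //= e //; exact: l1.
Qed.

Lemma selfadj_mirror d c : selfadj d c -> selfadj (mirror d) c.
Proof. by move=> sa n; have [] := sa (- n). Qed.

Section ready.
Context {d : dirac_data R} {L L' K K' : R} {kap kap' : int -> R}.
Hypotheses (A : admissible d L kap) (A' : admissible (mirror d) L' kap').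
Hypotheses (kapK : sum_bounded kap K) (kapK' : sum_bounded kap' K').

Lemma right_sol : sol d (right_u d) (right_v d).
Proof. exact (sol_mirror _ _ _ (left_sol A' kapK')). Qed.

Lemma green_ready_intro : jost_wronskian d != 0 ->
  green_ready d (normc (jost_wronskian d)^-1 *
    ((jost_const L K + jost_const L' K')
      * (jost_const L K + jost_const L' K'))).
Proof.
move=> W0; have J := jost_const_ge0 A (K := K);
  have J' := jost_const_ge0 A' (K := K').
have t0 := th_neq0 _ _ _ A; have t0' := normc_ge0 (th d).
split => //; [exact (left_sol A kapK) | exact right_sol | | exact: th_le1 A].
apply: kernel_boundI => // n.
  have [h1 h2] := left_bound A kapK n.
  by split; [apply: le_trans h1 _ | apply: le_trans h2 _];
    rewrite ler_wpM2r ?exprz_ge0 // lerDl.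
have [h1 h2] := left_bound A' kapK' (- n); move: h1 h2; rewrite opprK => h1 h2.
by split; [apply: le_trans h2 _ | apply: le_trans h1 _];
  rewrite ler_wpM2r ?exprz_ge0 // lerDr.
Qed.

Lemma jost_wronskian_neq0_nonreal c : selfadj d c -> c != 0 ->
  normc (th d) < 1 -> jost_wronskian d != 0.
Proof.
move=> sa c0 t1; apply: wronskian_neq0; rewrite flux_mirror.
have h1 := left_flux_nonreal A kapK c sa c0 t1 0.
have h2 := left_flux_nonreal A' kapK' c (selfadj_mirror _ _ sa) c0 t1 (1 - 0).
have c2 : 0 < c ^+ 2 by rewrite exprn_even_gt0.
move: (flux (left_u d) _ _) (flux (left_u (mirror d)) _ _) h1 h2 => x y h1 h2.
rewrite -(pmulr_rlt0 _ c2).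
have : 0 < (c * x) * (c * y) by rewrite nmulr_rgt0.
by rewrite expr2; lra.
Qed.

(** On the unit circle [th^-1] is the conjugate of [th], so [slope_minus * be0 = 1 - conjc th],
    where [be0] is real. *)
Lemma slope_minus_Im : complex.Im (be0 d) = 0 -> normc (th d) = 1 ->
  complex.Im (slope_minus d) * complex.Re (be0 d) = complex.Im (th d).
Proof.
move=> b1 t1; have b0 := be0_neq0 _ _ _ A; have t0 := th_neq0 _ _ _ A.
have tV : (th d)^-1 = conjc (th d).
  apply: (mulfI t0); rewrite mulfV //; move: t1 => /(congr1 (fun x => x ^+ 2)).
  rewrite normc_sqr expr1n; case: (th d) => x y /= h.
  by apply: complexP => /=; [rewrite -h|]; ring.
have : slope_minus d * be0 d = 1 - conjc (th d)
  by rewrite /slope_minus tV divfK.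
move=> /(congr1 (@complex.Im R)); rewrite complex_ImM b1 mulr0 add0r => ->.
by case: (th d) => x y /=; ring.
Qed.

End ready.

(** The left flux times [Re be0] and the mirrored one times [Re al0] are both [Im th]. As
    [Re al0 * Re be0] is positive these fluxes have the same sign, and the reflection makes the
    right one opposite. *)
Lemma jost_wronskian_neq0_real d L L' K K' kap kap' :
  admissible d L kap -> admissible (mirror d) L' kap' -> sum_bounded kap K ->
    sum_bounded kap' K' ->
  selfadj d 0 -> normc (th d) = 1 ->
  complex.Im (be0 d) = 0 -> complex.Im (al0 d) = 0 ->
  0 < complex.Re (al0 d) * complex.Re (be0 d) -> complex.Im (th d) != 0 ->
  jost_wronskian d != 0.
Proof.
move=> A A' kK kK' sa t1 b0 a0 ab ti; apply: wronskian_neq0.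
rewrite flux_mirror (left_flux_real A kK sa t1).
rewrite (left_flux_real A' kK' (selfadj_mirror _ _ sa) t1).
have h := slope_minus_Im A b0 t1; have /= h' := slope_minus_Im A' a0 t1.
move: (complex.Im (slope_minus d)) (complex.Im (slope_minus (mirror d)))
  h h' => x y h h'.
rewrite mulNr oppr_lt0 -(pmulr_lgt0 _ ab).
rewrite (_ : _ * _ = (x * complex.Re (be0 d)) * (y * complex.Re (al0 d)));
  last by ring.
by rewrite h h' -expr2 exprn_even_gt0.
Qed.

End Resolvent.

(** * Summability of the coefficients *)

Section Summability.
Context {R : realType}.

Lemma summable_zbnd (f : int -> R) : summable [set: int] (fun n => (f n)%:E) ->
  exists M, sum_bounded (fun n => `|f n|) M.
Proof.
rewrite /summable; set E := esum _ _ => h.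
have h0 : (0 <= E)%E by exact: esum_ge0.
exists (fine E); apply/esum_zbnd => //; rewrite fineK ?ge0_fin_numE //.
Qed.

(** [(1 + p)^-1] is at most 2 in modulus where [|p| <= 1/2], which holds outside a finite window;
    inside, the finite sum in [B] bounds it. *)
Lemma inv_zbnd (p : int -> R) M : sum_bounded (fun n => `|p n|) M ->
  (forall n, 1 + p n != 0) -> exists M',
    sum_bounded (fun n => `|(1 + p n)^-1 - 1|) M'.
Proof.
move=> pM p0; have h2 : 0 < 2^-1 :> R by rewrite invr_gt0.
have [N hN] := sum_bounded_tail _ _ (fun n => normr_ge0 (p n)) pM _ h2.
pose B := \sum_(j <- window N) `|(1 + p j)^-1| + 2.
have B0 : 0 <= \sum_(j <- window N) `|(1 + p j)^-1| by rewrite sumr_ge0.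
exists (B * M); apply: sum_bounded_le (sum_boundedZ _ _ B _ pM);
  last by rewrite addr_ge0.
move=> n; rewrite (_ : _ - 1 = - ((1 + p n)^-1 * p n)); last by field;
  exact: p0.
rewrite normrN normrM ler_wpM2r //.
have [nN|nN] := boolP (n \in window N).
  rewrite (@le_trans _ _ (\sum_(j <- window N) `|(1 + p j)^-1|)) ?lerDl //.
  by rewrite (bigD1_seq n) ?window_uniq //= lerDl sumr_ge0.
rewrite (@le_trans _ _ 2) ?lerDr // normrV ?unitfE ?p0 //.
have := hN [:: n] isT; rewrite big_seq1 => /(_ _) pn.
have {}pn : `|p n| <= 2^-1 by apply: pn => k; rewrite inE => /eqP ->.
rewrite -[leRHS]invrK lef_pV2 ?posrE ?invr_gt0 ?normr_gt0 ?p0 //.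
have := ler_normB (1 + p n) (p n); rewrite addrK normr1; lra.
Qed.

End Summability.

(** * The Floquet multiplier *)

Section Theta.
Context {R : realType}.

Lemma theta_ex (m lambda s eps : R) : 
  m ^+ 2 < lambda ^+ 2 -> lambda ^+ 2 < m ^+ 2 + 4 -> lambda != 0 -> s != 0 ->
  0 <= eps -> exists t : R[i],
  [/\ t != 0, t + t^-1 = 2 - (m%:C - (lambda +i* (s * eps)))
    * (- m%:C - (lambda +i* (s * eps))),
      0 < complex.Im t * (lambda * s),
      (0 < eps -> normc t < 1) & (eps = 0 -> normc t = 1)].
Proof.
move=> l1 l2 l0 s0; rewrite le_eqVlt => /predU1P[<-|e0].
  pose x : R := (2 + m ^+ 2 - lambda ^+ 2) / 2.
  have x1 : 0 < 1 - x ^+ 2.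
    have -> : 1 - x ^+ 2 = (lambda ^+ 2 - m ^+ 2) * (m ^+ 2 + 4 - lambda ^+ 2)
      / 4.
      by rewrite /x; field.
    by rewrite divr_gt0 // mulr_gt0 ?subr_gt0.
  (* Of the two conjugate roots on the circle, the one with the sign that the contracting roots have
     for [eps > 0]. *)
  pose y := Num.sg (lambda * s) * Num.sqrt (1 - x ^+ 2).
  have ls0 : lambda * s != 0 by rewrite mulf_neq0.
  have y2 : y ^+ 2 = 1 - x ^+ 2.
    by rewrite /y exprMn sqr_sqrtr ?ltW // sqr_sg ls0 mul1r.
  have yl : 0 < y * (lambda * s).
    by rewrite /y mulrAC -normrEsg mulr_gt0 ?normr_gt0 ?sqrtr_gt0.
  have tt : (x +i* y) * (x -i* y) = 1.
    by apply: complexP => /=; [rewrite mulrN opprK -!expr2 y2 | ]; ring.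
  have t0 : x +i* y != 0.
    by apply/eqP => t0; move: tt; rewrite t0 mul0r => /eqP;
      rewrite eq_sym oner_eq0.
  exists (x +i* y); split => //; last by move=> _;
    rewrite /normc y2 addrC subrK sqrtr1.
    have -> : (x +i* y)^-1 = x -i* y by apply: (mulfI t0); rewrite mulfV.
    by apply: complexP => /=; rewrite /x; [field | ring].
  by rewrite ltxx.
set tau := 2 - _.
have tauI : complex.Im tau = - (2 * (lambda * s) * eps) by rewrite /tau /=;
  ring.
have [r r2] : exists r : R[i], r ^+ 2 = tau ^+ 2 - 4.
  by exists (sqrtc (tau ^+ 2 - 4)); exact: sqr_sqrtc.
have pr : (tau + r) / 2 * ((tau - r) / 2) = 1.
  transitivity ((tau ^+ 2 - r ^+ 2) / 4); first by field.
  by rewrite r2; field.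
have ab : exists a b : R[i], [/\ a * b = 1, a + b = tau & normc a <= 1].
  have [h|h] := leP (normc ((tau + r) / 2)) 1.
    by exists ((tau + r) / 2), ((tau - r) / 2); split => //; field.
  exists ((tau - r) / 2), ((tau + r) / 2); split;
    [by rewrite mulrC | by field |].
  have := congr1 (fun x => normc x) pr; rewrite normcM normc1 => e.
  rewrite leNgt; apply/negP => h'; have := ltr_pM ler01 ler01 h h';
    rewrite mulr1.
  by rewrite e ltxx.
have [a [b [ab1 abt a1]]] := ab.
have a0 : a != 0.
  by apply/eqP => a0; move: ab1; rewrite a0 mul0r => /eqP;
    rewrite eq_sym oner_eq0.
have aV : a^-1 = b by apply: (mulfI a0); rewrite mulfV.
(* The imaginary part of [a + a^-1]. It excludes [|a| = 1], where the left-hand side vanishes, and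
   for [|a| < 1] the bracket is negative, so that [Im a] has the sign of [lambda * s]. *)
have key : complex.Im a * (1 - (normc a ^+ 2)^-1) = - (2 * (lambda * s) * eps).
  rewrite -tauI -abt -aV; case: a a0 {a1 ab1 abt aV} => x y a0.
  have n0 : x ^+ 2 + y ^+ 2 != 0.
    apply: contra a0; rewrite paddr_eq0 ?sqr_ge0 // !expf_eq0 /= => /andP[/eqP->
      /eqP->].
    by [].
  by rewrite normc_sqr /=; field.
have ls0 : lambda * s != 0 by rewrite mulf_neq0.
have n0 : 0 < normc a ^+ 2 by rewrite exprn_gt0 // normc_gt0.
have ne : normc a != 1.
  apply/eqP => e; move: key; rewrite e expr1n invr1 subrr mulr0 => /eqP.
  by rewrite eq_sym oppr_eq0 !mulf_eq0 (gt_eqF e0) -mulf_eq0 (negPf ls0)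
    pnatr_eq0.
have lt1 : normc a < 1 by rewrite lt_neqAle ne.
exists a; split => //; first by rewrite aV abt.
  have i1 : 0 < (normc a ^+ 2)^-1 - 1.
    by rewrite subr_gt0 invf_gt1 // exprn_ilt1 // normc_ge0.
  rewrite -(pmulr_lgt0 _ i1).
  have -> : complex.Im a * (lambda * s) * ((normc a ^+ 2)^-1 - 1) =
      - (complex.Im a * (1 - (normc a ^+ 2)^-1)) * (lambda * s) by ring.
  rewrite key opprK.
  have -> : 2 * (lambda * s) * eps * (lambda * s) = 2 * eps * (lambda * s)
    ^+ 2 by ring.
  by rewrite mulr_gt0 ?exprn_even_gt0 // mulr_gt0.
by move=> e; move: e0; rewrite e ltxx.
Qed.

(* Both roots of [X^2 - tau0 X + 1] lie on the unit circle and are conjugate;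
   the sign of the imaginary part keeps [t] away from the conjugate root. *)
Lemma theta_dist (t t0 : R[i]) (l : R) : t != 0 -> t0 != 0 ->
  normc t <= 1 -> normc t0 = 1 -> 0 < complex.Im t * l ->
    0 < complex.Im t0 * l ->
  normc (t - t0) * `|complex.Im t0| <= normc (t + t^-1 - (t0 + t0^-1)).
Proof.
move=> tn tn0 t1 t01 tl tl0.
have tV : t0^-1 = conjc t0.
  apply: (mulfI tn0); rewrite mulfV //;
    move: t01 => /(congr1 (fun x => x ^+ 2)).
  rewrite normc_sqr expr1n; case: (t0) => x y /= h.
  by apply: complexP => /=; [rewrite -h|]; ring.
have e : (t - t0) * (t - t0^-1) = t * (t + t^-1 - (t0 + t0^-1)) by field;
  rewrite tn tn0.
apply: (@le_trans _ _ (normc (t - t0) * normc (t - t0^-1))).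
  rewrite ler_wpM2l ?normc_ge0 // (le_trans _ (Im_le_normc _)) // tV.
  rewrite raddfB /= Im_conjc opprK.
  have l0 : l != 0 by apply: contraTneq tl => ->; rewrite mulr0 ltxx.
  have nl : 0 < `|l| by rewrite normr_gt0.
  rewrite -(ler_pM2r nl) -!normrM mulrDl !gtr0_norm ?addr_gt0 //.
  by rewrite lerDr ltW.
by rewrite -normcM e normcM ler_piMl ?normc_ge0.
Qed.

End Theta.

(** * The limit *)

Section Limit.
Context {R : realType}.

Lemma near_seq {T : Type} (F : set_system T) {FF : Filter F} (I : eqType)
    (r : seq I) (P : I -> T -> Prop) :
  (forall i, \forall t \near F, P i t) -> \forall t \near F, forall i,
    i \in r -> P i t.
Proof.
move=> h; elim: r => [|i r IH]; first by apply: nearW => t i.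
apply: filterS2 (h i) IH => t hi IH j; rewrite inE => /predU1P[->//|].
exact: IH.
Qed.

(** Dominated convergence in the weighted Hilbert-Schmidt norm: outside a window the weights are
    small and the kernel is bounded, inside only finitely many entries have to become small. *)
Lemma hs_small {T : Type} (F : set_system T) {FF : Filter F}
    (K : T -> int -> int -> R) (p : int -> R) (B P H : R) :
  (forall k, 0 <= p k) -> sum_bounded p P -> 0 < H ->
  (\forall t \near F, forall n k, K t n k ^+ 2 <= B) ->
  (forall n k, K t n k ^+ 2 @[t --> F] --> (0 : R)) ->
  \forall t \near F, forall r r', uniq r -> uniq r' ->
    \sum_(n <- r) \sum_(k <- r') p n * (K t n k ^+ 2 * p k) <= H.
Proof.
move=> p0 pP H0 KB K0; have P0 := sum_bounded_ge0 _ _ pP.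
pose B' := `|B|; have B'0 : 0 <= B' by exact: normr_ge0.
have den : 0 < 1 + 3 * P * (B' + P) by rewrite ltr_wpDr // !mulr_ge0 ?addr_ge0.
(* The two tail terms cost [B' * P * e] each and the window costs [P * P * e], in total at most
   [H]. *)
pose e := H / (1 + 3 * P * (B' + P)); have e0 : 0 < e by rewrite divr_gt0.
have [N hN] := sum_bounded_tail _ _ p0 pP _ e0.
have near_zs : \forall t \near F, forall n, n \in window N -> forall k,
  k \in window N ->
    K t n k ^+ 2 <= e.
  apply: near_seq => n; apply: near_seq => k.
  have /cvgrPdist_le/(_ _ e0) := K0 n k; apply: filterS => t.
  by rewrite sub0r normrN ger0_norm ?sqr_ge0.
near=> t; have KBt : forall n k, K t n k ^+ 2 <= B by near: t.
have zst : forall n, n \in window N -> forall k,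
  k \in window N -> K t n k ^+ 2 <= e.
  by near: t.
move=> r r' ur ur'; pose tl k : R := if k \in window N then 0 else p k.
have tl0 k : 0 <= tl k by rewrite /tl; case: ifP.
have tle (r1 : seq int) : uniq r1 -> \sum_(k <- r1) tl k <= e.
  move=> ur1; rewrite /tl (eq_bigr (fun k => if k \notin window N then p k else
    0)).
    rewrite -big_mkcond -big_filter hN ?filter_uniq // => k.
    by rewrite mem_filter => /andP[].
  by move=> k _; case: ifP.
have le n k : p n * (K t n k ^+ 2 * p k) <=
    B' * (tl n * p k) + (B' * (p n * tl k) + e * (p n * p k)).
  rewrite (_ : p n * _ = K t n k ^+ 2 * (p n * p k)); last by ring.
  have KB' : K t n k ^+ 2 <= B' by rewrite (le_trans (KBt n k)) // ler_norm.
  have pp : 0 <= p n * p k by rewrite mulr_ge0.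
  have t1 : 0 <= B' * (tl n * p k) by rewrite !mulr_ge0.
  have t2 : 0 <= B' * (p n * tl k) by rewrite !mulr_ge0.
  have t3 : 0 <= e * (p n * p k) := mulr_ge0 (ltW e0) pp.
  have := ler_wpM2r pp KB'; move: t1 t2; rewrite /tl.
  case: ifPn => nN; last by lra.
  case: ifPn => kN; last by lra.
  by move=> _ _ _; have := ler_wpM2r pp (zst n nN k kN); lra.
apply: (@le_trans _ _ (B' * (e * P) + (B' * (P * e) + e * (P * P))));
  last first.
  have -> : B' * (e * P) + (B' * (P * e) + e * (P * P))
    = e * (P * (2 * B' + P)) by ring.
  have : e * (1 + 3 * P * (B' + P)) = H by rewrite /e divfK ?gt_eqF.
  move=> <-; rewrite ler_wpM2l ?(ltW e0) //.
  by have := mulr_ge0 P0 B'0; have := mulr_ge0 P0 P0; lra.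
rewrite (le_trans (ler_sum _ (fun n _ => ler_sum _ (fun k _ => le n k)))) //.
have prod (x y : int -> R) c a b : 0 <= c -> (forall k, 0 <= x k) -> (forall k,
  0 <= y k) ->
    \sum_(n <- r) x n <= a -> \sum_(k <- r') y k <= b ->
    \sum_(n <- r) \sum_(k <- r') c * (x n * y k) <= c * (a * b).
  move=> c0 x0 y0 xa yb.
  rewrite (eq_bigr (fun n => c * (x n * \sum_(k <- r') y k))).
    by rewrite -mulr_sumr -mulr_suml ler_wpM2l // ler_pM ?sumr_ge0.
  by move=> n _; rewrite !mulr_sumr.
rewrite (eq_bigr (fun n => \sum_(k <- r') B' * (tl n * p k) +
   (\sum_(k <- r') B' * (p n * tl k) + \sum_(k <- r') e * (p n * p k))));
     last first.
  by move=> n _; rewrite !big_split.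
rewrite big_split /= [X in _ + X]big_split /= lerD //; last rewrite lerD //.
- by apply: prod; rewrite ?tle ?pP.
- by apply: prod; rewrite ?tle ?pP.
- by apply: prod; rewrite ?tle ?pP ?(ltW e0).
Unshelve. all: by end_near. Qed.

Definition kdist (d d' : dirac_data R) (n k : int) : R :=
  normc (cuu d n k - cuu d' n k) + normc (cuv d n k - cuv d' n k) +
  (normc (cvu d n k - cvu d' n k) + normc (cvv d n k - cvv d' n k)).

Lemma kdist_bound d d' B : green_ready d B -> green_ready d' B ->
  forall n k, 0 <= kdist d d' n k <= 8 * B.
Proof.
move=> g g' n k; rewrite !addr_ge0 ?normc_ge0 //=.
have [h1 h2 h3 h4] := gr_bound _ _ g n k;
  have [h1' h2' h3' h4'] := gr_bound _ _ g' n k.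
have B0 := kernel_const_ge0 (gr_bound _ _ g).
have e (x y : R[i]) : normc x <= B * normc (th d) ^+ `|n - k|%N ->
    normc y <= B * normc (th d') ^+ `|n - k|%N -> normc (x - y) <= B + B.
  move=> hx hy; rewrite (le_trans (normcB _ _)) // lerD //.
    by rewrite (le_trans hx) // ler_piMr ?(thX_le1 (gr_th _ _ g)).
  by rewrite (le_trans hy) // ler_piMr ?(thX_le1 (gr_th _ _ g')).
have := e _ _ h1 h1'; have := e _ _ h2 h2'; have := e _ _ h3 h3'.
by have := e _ _ h4 h4'; rewrite /kdist; lra.
Qed.

(** The factor 4 comes from the two components and the loss 2 in [abs_sum_sqr]. *)
Lemma green_dist d d' B s H : green_ready d B -> green_ready d' B -> 2^-1 < s ->
  0 <= H -> (forall r r', uniq r -> uniq r' ->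
    \sum_(n <- r) \sum_(k <- r')
      weight (- s) n * (kdist d d' n k ^+ 2 * weight (- s) k) <= H) ->
  (op_norm s (- s)%R (fun w => (green d w - green d' w)%R) <=
    (Num.sqrt (4 * H)%R)%:E)%E.
Proof.
move=> g g' s1 H0 KH; apply: op_norm_le; first by rewrite mulr_ge0.
move=> w M wM; have ws := (l2P _ _).2 (ex_intro _ _ wM).
have rw := rows_weighted (gr_bound _ _ g) (gr_th _ _ g) s w s1 ws.
have rw' := rows_weighted (gr_bound _ _ g') (gr_th _ _ g') s w s1 ws.
have ph : sum_bounded (fun k => abs_sum w k ^+ 2 / weight (- s) k) (2 * M).
  apply: sum_bounded_le (sum_boundedZ _ _ _ (ler0n _ 2) wM) => k.
  by rewrite weightN invrK [leLHS]mulrC [leRHS]mulrCA ler_wpM2l ?abs_sum_sqr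
    ?(ltW (weight_gt0 _ _)).
have sub (f1 f2 : int -> R[i]) a b : zcvg f1 a -> zcvg f2 b ->
    zcvg (fun k => f1 k - f2 k) (a - b).
  move=> fa gb; rewrite -[- b]mulN1r.
  apply: ccvg_ext (zcvgD _ _ _ _ fa (zcvgZ _ _ (-1) gb)) => N.
  by apply: eq_bigr => k _; rewrite mulN1r.
have bnd (c1 c1' c2 c2' x y : R[i]) : normc ((c1 * x + c2 * y)
  - (c1' * x + c2' * y)) <=
    (normc (c1 - c1') + normc (c2 - c2')) * (normc x + normc y).
  rewrite (_ : _ - _ = (c1 - c1') * x + (c2 - c2') * y); last by ring.
  rewrite (le_trans (normcD _ _)) // !normcM mulrDl !mulrDr.
  have := mulr_ge0 (normc_ge0 (c1 - c1')) (normc_ge0 y).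
  by have := mulr_ge0 (normc_ge0 (c2 - c2')) (normc_ge0 x); lra.
have bu n k : normc (kernel_upper d w n k - kernel_upper d' w n k)
  <= kdist d d' n k * abs_sum w k.
  rewrite (le_trans (bnd _ _ _ _ _ _)) // ler_wpM2r ?abs_sum_ge0 // /kdist.
  by rewrite lerDl addr_ge0 ?normc_ge0.
have bv n k : normc (kernel_lower d w n k - kernel_lower d' w n k)
  <= kdist d d' n k * abs_sum w k.
  rewrite (le_trans (bnd _ _ _ _ _ _)) // ler_wpM2r ?abs_sum_ge0 // /kdist.
  by rewrite lerDr addr_ge0 ?normc_ge0.
have h1 := hs_bound _ _ _ _ _ _ _ (weight_gt0 (- s)) bu
  (fun n => sub _ _ _ _ (rw n).1 (rw' n).1) KH ph.
have h2 := hs_bound _ _ _ _ _ _ _ (weight_gt0 (- s)) bv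
  (fun n => sub _ _ _ _ (rw n).2 (rw' n).2) KH ph.
have -> : 4 * H * M = H * (2 * M) + H * (2 * M) by ring.
apply: sum_bounded_le (sum_boundedD _ _ _ _ h1 h2) => k.
have e := densityB _ _ _ _ _ _ _ (upper_mk _ _ k) (upper_mk _ _ k)
  (lower_mk _ _ k) (lower_mk _ _ k).
by rewrite /green e mulrDr; exact: lexx.
Qed.

Lemma op_norm_ge0 s t (A : spinor R -> spinor R) : (0 <= op_norm s t A)%E.
Proof.
apply: (@le_trans _ _ (l2_norm t (A 0))); first exact: sqrte_ge0.
apply: ereal_sup_ubound; exists 0 => //=; apply/(l2_normP _ _ _ ler01) => r _.
rewrite big1 ?expr1n // => k _.
by rewrite /density upper0 lower0 normc0 expr0n addr0 mulr0.
Qed.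

Lemma op_norm_ext s t (A A' : spinor R -> spinor R) :
  (forall w, l2 s w -> A w = A' w) -> op_norm s t A = op_norm s t A'.
Proof.
move=> e; congr ereal_sup.
have l1 w : (l2_norm s w <= 1)%E -> l2 s w by move=> h;
  exact: le_lt_trans h (ltry 1).
by apply/seteqP; split => _ [w /= w1 <-]; exists w; rewrite //= e //; exact: l1.
Qed.

Lemma op_norm_cvg0 {T : Type} (F : set_system T) {FF : Filter F}
    (A : T -> spinor R -> spinor R) s t :
  (forall eta, 0 < eta -> \forall x \near F, (op_norm s t (A x) <= eta%:E)%E) ->
  op_norm s t (A x) @[x --> F] --> 0%E.
Proof.
move=> h; apply/fine_cvgP; split.
  apply: filterS (h 1 ltr01) => x hx; rewrite ge0_fin_numE ?op_norm_ge0 //.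
  exact: le_lt_trans hx (ltry 1).
apply/cvgrPdist_le => eta eta0; apply: filterS (h eta eta0) => x hx /=.
rewrite sub0r normrN ger0_norm ?fine_ge0 ?op_norm_ge0 //.
rewrite -lee_fin fineK // ge0_fin_numE ?op_norm_ge0 //.
exact: le_lt_trans hx (ltry eta).
Qed.

End Limit.

(** * Limiting absorption along a vertical ray *)

Section LimitingAbsorption.
Context {R : realType} {m lambda s : R} {Q : int -> 'M[R]_2} {q : int ->
  R} {K : R}.
Hypotheses (lambda_gt : m ^+ 2 < lambda ^+ 2)
  (lambda_lt : lambda ^+ 2 < m ^+ 2 + 4).
Hypotheses (lambda_neq0 : lambda != 0) (s_neq0 : s != 0).
Hypothesis (Q_sym : forall n, Q n 0 1 = Q n 1 0).
Hypothesis (qQ : forall z t, perturbation (dirac_at m Q z t) q).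
Hypothesis (qK : sum_bounded q K).

Let z (eps : R) : R[i] := lambda +i* (s * eps).

Variable theta : R -> R[i].
Hypothesis thetaP : forall eps, 0 <= eps ->
  [/\ theta eps != 0,
      theta eps + (theta eps)^-1 = 2 - (m%:C - z eps) * (- m%:C - z eps),
      0 < complex.Im (theta eps) * (lambda * s),
      (0 < eps -> normc (theta eps) < 1) & (eps = 0 -> normc (theta eps) = 1)].

Let D eps := dirac_at m Q (z eps) (theta eps).

Lemma theta_le1 eps : 0 <= eps -> normc (theta eps) <= 1.
Proof.
move=> e0; have [_ _ _ t1 t0] := thetaP _ e0.
move: e0; rewrite le_eqVlt => /predU1P[e|/t1/ltW//].
by rewrite (t0 (esym e)).
Qed.

(** [al0] and [be0] vanish only for [z = m] or [z = - m], excluded by [Re z = lambda]; [th = th^-1]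
    would make [th] real, against the sign condition. *)
Lemma D_nondegen eps : 0 <= eps -> nondegen (D eps).
Proof.
move=> e0; have [tn tr ti _ _] := thetaP _ e0.
have neq (a : R) : a ^+ 2 = m ^+ 2 -> a%:C - z eps != 0.
  move=> am; apply/eqP => /(congr1 (@complex.Re R)) /= /eqP.
  by rewrite subr_eq0 => /eqP al; move: lambda_gt; rewrite -am al ltxx.
split => //=; [exact: neq | | exact: theta_le1 |].
  by rewrite -rmorphN; apply: neq; rewrite sqrrN.
apply/eqP => tV; have : theta eps ^+ 2 = 1 by rewrite expr2 -{1}tV mulVf.
move/eqP; rewrite sqrf_eq1 => /orP[] /eqP e; move: ti; rewrite e /=.
  by rewrite mul0r ltxx.
by rewrite oppr0 mul0r ltxx.
Qed.

Lemma D_selfadj eps : selfadj (D eps) (s * eps).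
Proof. by move=> n; split => /=; ring. Qed.

Lemma D_admissible eps : 0 <= eps -> exists L kap K',
  sum_bounded kap K' /\ admissible (D eps) L kap.
Proof.
move=> e0; have nd := D_nondegen _ e0.
(* The uniform statement, applied to a constant family indexed by [nat], yields constants for a
   single [eps]. *)
have ndn : \forall N \near \oo, nondegen (D eps) /\ perturbation (D eps) q.
  by apply: nearW => N; split => //; exact: qQ.
have [L [kap [K' [k1 A _]]]] := uniformly_admissible \oo
  (data_cvg_cst \oo (D eps)) nd (qQ _ _) ndn qK.
by exists L, kap, K'.
Qed.

Lemma D_admissible_mirror eps : 0 <= eps -> exists L kap K',
  sum_bounded kap K' /\ admissible (mirror (D eps)) L kap.
Proof.
move=> e0; have nd := nondegen_mirror _ (D_nondegen _ e0).
have qK' : sum_bounded (fun n => q (- n))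
  K by apply: (sum_bounded_inj _ _ (fun n => - n) _ qK) => x y; lia.
have pt := perturbation_mirror _ _ (qQ (z eps) (theta eps)).
have ndn : \forall N \near \oo, nondegen (mirror (D eps)) /\
    perturbation (mirror (D eps)) (fun n => q (- n)).
  by apply: nearW => N; split.
have [L [kap [K' [k1 A _]]]] := uniformly_admissible \oo
  (data_cvg_cst \oo (mirror (D eps))) nd pt ndn qK'.
by exists L, kap, K'.
Qed.

Lemma D_W_neq0 eps : 0 <= eps -> jost_wronskian (D eps) != 0.
Proof.
move=> e0; have [L [kap [K1 [k1 A]]]] := D_admissible _ e0.
have [L' [kap' [K1' [k1' A']]]] := D_admissible_mirror _ e0.
have [tn tr ti t1 t0] := thetaP _ e0.
move: (e0); rewrite le_eqVlt => /predU1P[e|ep]; last first.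
  have c0 : s * eps != 0 by rewrite mulf_neq0 // gt_eqF.
  exact: jost_wronskian_neq0_nonreal A A' k1 k1' (s * eps) (D_selfadj eps)
    c0 (t1 ep).
have sa : selfadj (D eps) 0 by have := D_selfadj eps; rewrite -e mulr0.
apply: (jost_wronskian_neq0_real _ _ _ _ _ _ _ A A' k1 k1' sa).
- by apply: t0.
- by rewrite /= -e mulr0; ring.
- by rewrite /= -e mulr0; ring.
- by rewrite /=; move: lambda_gt; lra.
- by apply: contraTneq ti => /= ->; rewrite mul0r ltxx.
Qed.

Lemma D_ready eps : 0 <= eps -> exists B, green_ready (D eps) B.
Proof.
move=> e0; have [L [kap [K1 [k1 A]]]] := D_admissible _ e0.
have [L' [kap' [K1' [k1' A']]]] := D_admissible_mirror _ e0.
eexists; exact: green_ready_intro A A' k1 k1' (D_W_neq0 _ e0).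
Qed.

Lemma D_coef_bounded eps : exists M, forall n,
  [/\ normc (al (D eps) n) <= M, normc (be (D eps) n) <= M & normc (pc (D eps)
    n) <= M].
Proof.
have pt := qQ (z eps) (theta eps).
exists (normc (al0 (D eps)) + normc (be0 (D eps)) + 1 + K) => n.
have qn := sum_bounded_single _ _ n qK.
have b (x y : R[i]) : normc (x - y) <= q n -> normc x <= normc y + K.
  move=> h; rewrite -[x](subrK y) (le_trans (normcD _ _)) // addrC lerD2l.
  exact: le_trans h qn.
have ha := b _ _ (pt_al _ _ pt n); have hb := b _ _ (pt_be _ _ pt n).
have hp := b _ _ (pt_pc1 _ _ pt n); rewrite normc1 in hp.
have := normc_ge0 (al0 (D eps)); have := normc_ge0 (be0 (D eps));
  move: ha hb hp.
by rewrite -/(D eps) => *; split; lra.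
Qed.

Lemma D_resolvent eps : 0 < eps ->
  resolvent_set m Q (z eps) /\
  (forall w, l2 0 w -> resolvent m Q (z eps) w = green (D eps) w).
Proof.
move=> ep; have [B gr] := D_ready _ (ltW ep).
have [_ _ _ t1 _] := thetaP _ (ltW ep).
have c0 : s * eps != 0 by rewrite mulf_neq0 // gt_eqF.
have [bij e] := resolvent_green _ _ _ _ _ _ Q_sym gr (t1 ep) (D_selfadj eps)
  c0 (D_coef_bounded eps).
split; last exact: e.
split; first exact: bij.
by apply: bounded_ops_ext (bounded_green0 _ _ gr (t1 ep)) => w hw; rewrite e.
Qed.

Lemma z_cvg : ccvg (0 : R)^'+ z (z 0).
Proof.
split => /=; first exact: cvg_cst.
by apply: cvg_at_right_filter; apply: cvgMr; exact: cvg_id.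
Qed.

(** Convergence is inherited from the trace [tau] through [theta_dist], with no continuous branch of
    the square root. *)
Lemma theta_cvg : ccvg (0 : R)^'+ theta (theta 0).
Proof.
have [tn0 tr0 ti0 _ t0] := thetaP _ (lexx 0).
have i0 : 0 < `|complex.Im (theta 0)|.
  by rewrite normr_gt0; apply: contraTneq ti0 => ->; rewrite mul0r ltxx.
pose tau e : R[i] := 2 - (m%:C - z e) * (- m%:C - z e).
have tauc : ccvg (0 : R)^'+ tau (tau 0).
  apply: ccvgB; first exact: ccvg_cst.
  by apply: ccvgM; apply: ccvgB z_cvg; exact: ccvg_cst.
apply: dist_ccvg; apply/cvgrPdist_le => eta eta0.
have e0 : 0 < eta * `|complex.Im (theta 0)| by rewrite mulr_gt0.
pose proof (ccvg_dist _ _ tauc) as h; move/cvgrPdist_le/(_ _ e0) : h => h.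
near=> e; have ep : 0 < e by near: e; exact: nbhs_right_gt.
have [tn tr ti t1 _] := thetaP _ (ltW ep).
have := theta_dist _ _ _ tn tn0 (ltW (t1 ep)) (t0 erefl) ti ti0.
rewrite tr tr0 -/(tau e) -/(tau 0) sub0r normrN (ger0_norm (normc_ge0 _)) => d.
rewrite -(ler_pM2r i0) (le_trans d) //.
have : `|0 - normc (tau e - tau 0)| <= eta * `|complex.Im (theta 0)| by near: e.
by rewrite sub0r normrN ger0_norm ?normc_ge0.
Unshelve. all: by end_near. Qed.

Lemma D_cvg : data_cvg (0 : R)^'+ D (D 0).
Proof.
have zc := z_cvg; have tc := theta_cvg.
by split => [n|n|n||| ] //=; try (by apply: ccvgB => //; exact: ccvg_cst);
  exact: ccvg_cst.
Qed.

Lemma D_nondegen_near :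
  \forall eps \near (0 : R)^'+, nondegen (D eps) /\ perturbation (D eps) q.
Proof.
near=> e; have ep : 0 < e by near: e; exact: nbhs_right_gt.
by split; [exact: D_nondegen (ltW ep) | exact: qQ].
Unshelve. all: by end_near. Qed.

Lemma D_uniform : exists B,
  [/\ green_ready (D 0) B, \forall eps \near (0 : R)^'+, green_ready (D eps) B
    & forall n k, kdist (D eps) (D 0) n k ^+ 2 @[eps --> (0 : R)^'+]
      --> (0 : R)].
Proof.
have nd0 := D_nondegen _ (lexx 0).
have [L [kap [K1 [k1 A0 A]]]] :=
  uniformly_admissible _ D_cvg nd0 (qQ _ _) D_nondegen_near qK.
have qK' : sum_bounded (fun n => q (- n))
  K by apply: (sum_bounded_inj _ _ (fun n => - n) _ qK) => x y; lia.
have ndm : \forall eps \near (0 : R)^'+, nondegen (mirror (D eps)) /\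
    perturbation (mirror (D eps)) (fun n => q (- n)).
  apply: filterS D_nondegen_near => e [nd pt].
  by split; [exact: nondegen_mirror | exact: perturbation_mirror].
have Dm := data_cvg_mirror _ _ _ D_cvg.
have [L' [kap' [K1' [k1' A0' A']]]] :=
  uniformly_admissible _ Dm (nondegen_mirror _ nd0)
  (perturbation_mirror _ _ (qQ _ _)) ndm qK'.
have lc n : ccvg (0 : R)^'+ (fun e => left_u (D e) n) (left_u (D 0) n).
  by have [] := left_ccvg _ D_cvg A0 A k1 n.
have lc' n : ccvg (0 : R)^'+ (fun e => left_v (D e) n) (left_v (D 0) n).
  by have [] := left_ccvg _ D_cvg A0 A k1 n.
have rc n : ccvg (0 : R)^'+ (fun e => right_u (D e) n) (right_u (D 0) n).
  by have [] := left_ccvg _ Dm A0' A' k1' (- n).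
have rc' n : ccvg (0 : R)^'+ (fun e => right_v (D e) n) (right_v (D 0) n).
  by have [] := left_ccvg _ Dm A0' A' k1' (- n).
have Wc : ccvg (0 : R)^'+ (fun e => jost_wronskian (D e))
  (jost_wronskian (D 0)).
  by apply: ccvgB; exact: ccvgM.
pose proof (ccvgV _ _ (D_W_neq0 _ (lexx 0)) Wc) as WVc.
pose J := jost_const L K1 + jost_const L' K1'.
have J0 : 0 <= J by rewrite addr_ge0 ?(jost_const_ge0 A0) ?(jost_const_ge0 A0').
pose B := (normc (jost_wronskian (D 0))^-1 + 1) * (J * J).
have weaken d b : green_ready d b -> b <= B -> green_ready d B.
  move=> [? ? ? kb ?] bB; split => // n k; have [h1 h2 h3 h4] := kb n k.
  have x0 : 0 <= normc (th d) ^+ `|n - k|%N by rewrite exprn_ge0 ?normc_ge0.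
  by split; [apply: le_trans h1 _ | apply: le_trans h2 _ | apply: le_trans h3 _
    |
    apply: le_trans h4 _]; rewrite ler_wpM2r.
exists B; split.
- apply: weaken (green_ready_intro A0 A0' k1 k1' (D_W_neq0 _ (lexx 0))) _.
  by rewrite ler_wpM2r ?mulr_ge0 // lerDl.
- pose proof (ccvg_bounded _ _ _ WVc) as WB.
  near=> e; have ep : 0 < e by near: e; exact: nbhs_right_gt.
  have Ae : admissible (D e) L kap by near: e.
  have Ae' : admissible (mirror (D e)) L' kap' by near: e.
  apply: weaken (green_ready_intro Ae Ae' k1 k1' (D_W_neq0 _ (ltW ep))) _.
  by rewrite ler_wpM2r ?mulr_ge0 //; near: e.
move=> n k.
have c1 : ccvg (0 : R)^'+ (fun e => cuu (D e) n k) (cuu (D 0) n k).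
  by apply: ccvgM => //; case: ifP => _; exact: ccvgM.
have c2 : ccvg (0 : R)^'+ (fun e => cuv (D e) n k) (cuv (D 0) n k).
  by apply: ccvgM => //; case: ifP => _; exact: ccvgM.
have c3 : ccvg (0 : R)^'+ (fun e => cvu (D e) n k) (cvu (D 0) n k).
  by apply: ccvgM => //; case: ifP => _; exact: ccvgM.
have c4 : ccvg (0 : R)^'+ (fun e => cvv (D e) n k) (cvv (D 0) n k).
  by apply: ccvgM => //; case: ifP => _; exact: ccvgM.
have kc : kdist (D eps) (D 0) n k @[eps --> (0 : R)^'+]
  --> (0 + 0 + (0 + 0) : R).
  by apply: cvgD; apply: cvgD; exact: ccvg_dist.
rewrite !addr0 in kc; rewrite -[X in _ --> X](mulr0 0).
by under eq_fun do rewrite expr2; exact: cvgM.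
Unshelve. all: by end_near. Qed.

Lemma limiting_absorption_aux sigma : 2^-1 < sigma ->
  (forall eps, 0 < eps -> resolvent_set m Q (lambda +i* (s * eps)) /\
     bounded_ops sigma (- sigma) (resolvent m Q (lambda +i* (s * eps)))) /\
  exists2 R0 : spinor R -> spinor R, bounded_ops sigma (- sigma) R0 &
    op_norm sigma (- sigma)
      (fun w => resolvent m Q (lambda +i* (s * eps)) w - R0 w)
      @[eps --> 0^'+] --> 0%E.
Proof.
move=> s1; have sg0 : 0 <= sigma by lra.
(* For [sigma >= 0] the weighted space lies in [l2 0], where the resolvent is the Green operator. *)
have resE eps w : 0 < eps -> l2 sigma w ->
  resolvent m Q (z eps) w = green (D eps) w.
  by move=> ep /(l2_sub0 _ _ sg0); have [_ h] := D_resolvent _ ep; exact: h.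
split=> [eps ep|].
  have [B gr] := D_ready _ (ltW ep); split;
    first by have [] := D_resolvent _ ep.
  by apply: bounded_ops_ext (bounded_green _ _ _ gr s1) => w hw; rewrite -resE.
have [B [g0 gn kc]] := D_uniform.
exists (green (D 0)); first exact: bounded_green g0 s1.
have [P hP] := weight_summable sigma s1.
apply: op_norm_cvg0 => eta eta0.
have H0 : 0 < eta ^+ 2 / 4 by rewrite divr_gt0 // exprn_gt0.
have kB : \forall e \near (0 : R)^'+, forall n k,
  kdist (D e) (D 0) n k ^+ 2 <= (8 * B) ^+ 2.
  apply: filterS gn => e ge n k; have /andP[k0 k8] :=
    kdist_bound _ _ _ ge g0 n k.
  by rewrite ler_pXn2r ?nnegrE // (le_trans k0 k8).
have w0 k : 0 <= weight (- sigma) k := ltW (weight_gt0 _ _).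
have small := hs_small _ _ _ _ _ _ w0 hP H0 kB kc.
near=> e; have ep : 0 < e by near: e; exact: nbhs_right_gt.
have ge : green_ready (D e) B by near: e.
rewrite (op_norm_ext _ _ _ (fun w => green (D e) w - green (D 0) w));
  last first.
  by move=> w hw; congr (_ - _); exact: resE.
have -> : eta = Num.sqrt (4 * (eta ^+ 2 / 4)).
  by rewrite mulrC divfK // sqrtr_sqr gtr0_norm.
apply: green_dist ge g0 s1 (ltW H0) _; near: e; exact: small.
Unshelve. all: by end_near. Qed.

End LimitingAbsorption.

(** The curve [z] is a parameter given by an equation, so that [lambda +i* eps] and [lambda -i* eps]
    both fit after multiplication of [eps] by 1 or -1. *)
Lemma limiting_absorption (R : realType) (m : R) (Q : int -> 'M[R]_2)
    (lambda s sigma : R) (z : R -> R[i]) :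
  (forall eps, z eps = lambda +i* (s * eps)) ->
  m ^+ 2 < lambda ^+ 2 -> lambda ^+ 2 < m ^+ 2 + 4 -> s != 0 -> 2^-1 < sigma ->
  (forall n, Q n 0 1 = Q n 1 0) -> (forall n, Q n 1 0 != -1) ->
  (forall i j, summable [set: int] (fun n => (Q n i j)%:E)) ->
  (forall eps, 0 < eps -> resolvent_set m Q (z eps) /\
     bounded_ops sigma (- sigma) (resolvent m Q (z eps))) /\
  exists2 R0 : spinor R -> spinor R, bounded_ops sigma (- sigma) R0 &
    op_norm sigma (- sigma) (fun w => resolvent m Q (z eps) w - R0 w)
      @[eps --> 0^'+] --> 0%E.
Proof.
move=> /funext -> l1 l2 s0 sg Qs Q1 Qsum {z}.
have l0 : lambda != 0.
  by apply: contraTneq l1 => ->; rewrite -leNgt expr0n /= sqr_ge0.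
have p0 n : 1 + Q n 1 0 != 0 by rewrite addrC addr_eq0 Q1.
have [M0 h0] := summable_zbnd _ (Qsum 0 0);
  have [M1 h1] := summable_zbnd _ (Qsum 1 1).
have [M2 h2] := summable_zbnd _ (Qsum 1 0); have [M3 h3] := inv_zbnd _ _ h2 p0.
have qK := sum_boundedD _ _ _ _ (sum_boundedD _ _ _ _ h0 h1)
  (sum_boundedD _ _ _ _ h2 h3).
have qQ z t : perturbation (dirac_at m Q z t)
  (fun n => `|Q n 0 0| + `|Q n 1 1| +
    (`|Q n 1 0| + `|(1 + Q n 1 0)^-1 - 1|)).
  split => n; rewrite -?[pc _ _]/((1 + Q n 1 0)%:C).
  - by apply/eqP => /(congr1 (@complex.Re R)) /= /eqP; rewrite (negPf (p0 n)).
  - rewrite (_ : _ - _ = (Q n 0 0)%:C) ?normc_real; last by rewrite /= rmorphD;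
    ring.
    by rewrite -addrA lerDl !addr_ge0.
  - rewrite (_ : _ - _ = (Q n 1 1)%:C) ?normc_real; last by rewrite /= rmorphB;
    ring.
    by rewrite -addrA addrCA lerDl !addr_ge0.
  - rewrite (_ : _ - 1 = (Q n 1 0)%:C) ?normc_real;
    last by rewrite rmorphD rmorph1; ring.
    by rewrite addrCA lerDl !addr_ge0.
  - rewrite (_ : _ - 1 = ((1 + Q n 1 0)^-1 - 1)%:C) ?normc_real; last first.
      by rewrite rmorphB rmorph1 fmorphV.
    by rewrite addrA lerDr !addr_ge0.
(* The condition [0 <= eps] sits under the existential so that choice yields a total function;
   negative [eps] get the value 0. *)
have /choice[theta thetaP] : forall eps, exists t : R[i], 0 <= eps ->
    [/\ t != 0, t + t^-1 = 2 - (m%:C - (lambda +i* (s * eps)))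
      * (- m%:C - (lambda +i* (s * eps))),
      0 < complex.Im t * (lambda * s),
      (0 < eps -> normc t < 1) & (eps = 0 -> normc t = 1)].
  move=> eps; have [e0|e0] := leP 0 eps; last by exists 0.
  by have [t ht] := theta_ex m lambda s eps l1 l2 l0 s0 e0; exists t.
exact: (limiting_absorption_aux l1 l2 l0 s0 Qs qQ qK theta thetaP sigma sg).
Qed.

Theorem lemma5p2 (R : realType) (m : R) (Q : int -> 'M[R]_2)
    (m_gt0 : 0 < m)
    (Q_sym : forall n, Q n 0 1 = Q n 1 0)
    (Q_neqN1 : forall n, Q n 1 0 != -1)
    (Q_ell1 : forall i j, summable [set: int] (fun n => (Q n i j)%:E))
    (lambda : R) (lambda_Gamma : Gamma m lambda)
    (sigma : R) (sigma_gt : 2^-1 < sigma) :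
  (forall eps : R, 0 < eps ->
     [/\ resolvent_set m Q (lambda +i* eps),
         resolvent_set m Q (lambda -i* eps),
         bounded_ops sigma (- sigma) (resolvent m Q (lambda +i* eps))
       & bounded_ops sigma (- sigma) (resolvent m Q (lambda -i* eps))]) /\
  exists Rplus Rminus : spinor R -> spinor R,
    [/\ bounded_ops sigma (- sigma) Rplus,
        bounded_ops sigma (- sigma) Rminus,
        op_norm sigma (- sigma)
          (fun w => resolvent m Q (lambda +i* eps) w - Rplus w)
          @[eps --> 0^'+] --> 0%E
      & op_norm sigma (- sigma)
          (fun w => resolvent m Q (lambda -i* eps) w - Rminus w)
          @[eps --> 0^'+] --> 0%E].
Proof.
have [l1 l2] : m ^+ 2 < lambda ^+ 2 /\ lambda ^+ 2 < m ^+ 2 + 4.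
  have c0 : 0 <= m ^+ 2 + 4 by rewrite addr_ge0 ?sqr_ge0.
  (* With [m^2 + 4] as the square of its root, both claims are signs of differences of squares,
     decided factor by factor on each interval of [Gamma]. *)
  rewrite -(sqr_sqrtr c0).
  by case: lambda_Gamma => /= /andP[h1 h2]; split; rewrite -subr_gt0 subr_sqr;
    (rewrite nmulr_lgt0; lra) || (rewrite pmulr_lgt0; lra).
have N1 : -1 != 0 :> R by rewrite oppr_eq0 oner_neq0.
have [res_p [Rp bp cp]] := limiting_absorption R m Q lambda 1 sigma
  (fun eps => lambda +i* eps) (fun eps => congr1 _ (esym (mul1r eps)))
  l1 l2 (oner_neq0 _) sigma_gt Q_sym Q_neqN1 Q_ell1.
have [res_m [Rm bm cm]] := limiting_absorption R m Q lambda (-1) sigma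
  (fun eps => lambda -i* eps) (fun eps => congr1 _ (esym (mulN1r eps)))
  l1 l2 N1 sigma_gt Q_sym Q_neqN1 Q_ell1.
split; last first.
  by exists Rp, Rm; split; [exact: bp | exact: bm | exact: cp | exact: cm].
by move=> eps eps0; have [] := res_p eps eps0; have [] := res_m eps eps0.
Qed.
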